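(* For every integer $d \geq 2$ there exist constants $c_d > 0$ and $C_d$ such that for every finite abelian group $G$, $$c_d(\log |G|)^{1/d} \leq T_d(G) \leq C_d(\log |G|)^{1/d}.$$
   Context: All homology is simplicial homology with integer coefficients. For an abelian group $A$, $A_T$ denotes its torsion subgroup. For $d \geq 2$ and a finite abelian group $G$, $T_d(G)$ is the minimum number $n$ of vertices such that there exists a (finite abstract) simplicial complex $X$ on $n$ vertices with $H_{d-1}(X)_T \cong G$. *)

(* Defs.v *)
From HB Require Import structures.
From mathcomp Require Import all_boot all_order all_algebra.
Set Implicit Arguments. Unset Strict Implicit. Unset Printing Implicit Defensive.
Import Order.TTheory GRing.Theory Num.Theory.
Local Open Scope ring_scope.

Definition is_complex n (X : {set {set 'I_n}}) : Prop :=
  set0 \notin X /\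
  forall s t : {set 'I_n}, s \in X -> t \subset s -> t != set0 -> t \in X.

Definition chain n := {ffun {set 'I_n} -> int}.

(* Simplicial boundary, faces oriented by the natural order of vertices:
   d[v_0 < ... < v_k] = sum_i (-1)^i [v_0..^v_i..v_k]. *)
Definition bd n (c : chain n) : chain n :=
  [ffun t : {set 'I_n} =>
     \sum_(v : 'I_n | v \notin t)
        (-1) ^+ #|[set u in t | (nat_of_ord u < nat_of_ord v)%N]| * c (v |: t)].

Definition kchain n (X : {set {set 'I_n}}) (k : nat) (c : chain n) : Prop :=
  forall s, c s != 0 -> s \in X /\ #|s| = k.+1.

Definition kcycle n (X : {set {set 'I_n}}) k (c : chain n) : Prop :=
  kchain X k c /\ bd c = 0.

Definition kboundary n (X : {set {set 'I_n}}) k (c : chain n) : Prop :=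
  exists b, kchain X k.+1 b /\ c = bd b.

Definition torsion_cycle n (X : {set {set 'I_n}}) k (z : chain n) : Prop :=
  kcycle X k z /\ exists m : nat, (0 < m)%N /\ kboundary X k (z *+ m).

(* H_k(X)_T is isomorphic to the finite abelian group G: a map f sending
   each g to a representative cycle, inducing a bijective group homomorphism
   G -> H_k(X)_T = (torsion cycles) / (boundaries). *)
Definition torsion_homology_iso n (X : {set {set 'I_n}}) k (G : finZmodType)
  : Prop :=
  exists f : G -> chain n,
    [/\ forall g, torsion_cycle X k (f g),
        forall g h, kboundary X k (f (g + h) - f g - f h),
        forall g, kboundary X k (f g) -> g = 0 &
        forall z, torsion_cycle X k z -> exists g, kboundary X k (z - f g)].

Definition realizable (d : nat) (G : finZmodType) (n : nat) : Prop :=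
  exists X : {set {set 'I_n}}, is_complex X /\ torsion_homology_iso X d.-1 G.

Definition is_Td (d : nat) (G : finZmodType) (n : nat) : Prop :=
  realizable d G n /\ forall m, realizable d G m -> (n <= m)%N.

(* Main.v *)
(** Lower bound: the torsion of H_(d-1)(X) is the torsion of the cokernel of the
    boundary matrix in dimension d, so its order is at most the absolute value of
    a nonzero maximal minor.  Each row of that matrix has l1-norm d+1 and the minor
    has size at most C(n,d), hence |G| <= (d+1)^(n^d).

    Upper bound: fix a cone point 0, a set F of (d+1)-sets and a set L of d-sets
    avoiding 0.  Take for X the full (d-1)-skeleton, F, and the cones 0*s over all
    d-sets s outside L.  The cones kill every d-set outside L, so H_(d-1)(X) is the
    group generated by L with one relation for each element of F.  Choosing F inside
    a complete (d+1)-partite complex with parts of size O(q), the (d+1)-sets are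
    the points of a (d+1)-dimensional grid, the d-sets are its axis-parallel lines,
    and after re-signing each point says that the sum of the lines of L through it
    vanishes.  The lines in direction 0 are indexed by a d-dimensional grid of about
    q^d sites; auxiliary lines in the other directions impose at each site a relation
    "the generator here is the sum of chosen generators at sites differing in one
    coordinate".  Along a Gray code of q^d blocks of sites such relations carry out
    Horner's double-and-add scheme, producing the relation m e = 0 in about log2 m
    blocks for each cyclic summand Z/m of G. *)

Require Import Defs.
From HB Require Import structures.
From mathcomp Require Import all_boot all_order all_algebra all_fingroup all_solvable.
From mathcomp Require Import ring lra zify.
Set Implicit Arguments. Unset Strict Implicit. Unset Printing Implicit Defensive.
Import Order.TTheory GRing.Theory Num.Theory.

(* The reflected q-ary Gray code: digit [k] of the [c]-th word of length [d];
   odd values of the leading digit traverse the shorter code backwards. *)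
Fixpoint gray (q d c k : nat) : nat :=
  if d is d'.+1 then
    if k == d' then c %/ q ^ d' else
    gray q d' (if odd (c %/ q ^ d') then (q ^ d').-1 - c %% q ^ d' else c %% q ^ d') k
  else 0.

(** * Consecutive words of the reflected Gray code *)

Section Gray.
Variable q : nat.
Hypothesis q_gt0 : 0 < q.
Let refl (d c : nat) :=
  if odd (c %/ q ^ d) then (q ^ d).-1 - c %% q ^ d else c %% q ^ d.

Let refl_lt d c : refl d c < q ^ d.
Proof.
have Q0 : 0 < q ^ d by rewrite expn_gt0 q_gt0.
have := ltn_pmod c Q0; rewrite /refl; case: odd; lia.
Qed.

Let refl_inj d c c' : c %/ q ^ d = c' %/ q ^ d -> refl d c = refl d c' -> c = c'.
Proof.
have Q0 : 0 < q ^ d by rewrite expn_gt0 q_gt0.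
move=> e; rewrite /refl -e.
have := ltn_pmod c Q0; have := ltn_pmod c' Q0.
rewrite [c in _ -> c = _](divn_eq c (q ^ d)) [c' in _ -> _ = c'](divn_eq c' (q ^ d)) -e.
case: odd; lia.
Qed.

Lemma gray_lt d c k : c < q ^ d -> gray q d c k < q.
Proof.
elim: d c => [|d IH] c //= cq; case: eqP => _; last exact/IH/refl_lt.
by rewrite ltn_divLR ?expn_gt0 ?q_gt0 // -expnS.
Qed.

Lemma gray_inj d c c' : c < q ^ d -> c' < q ^ d ->
  (forall k, k < d -> gray q d c k = gray q d c' k) -> c = c'.
Proof.
elim: d c c' => [|d IH] c c'; first by rewrite !ltnS !leqn0 => /eqP-> /eqP->.
move=> cq c'q e; have := e d (ltnSn d); rewrite /= eqxx => ed.
apply: (refl_inj ed); apply: IH; rewrite ?refl_lt // => k kd.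
by have := e k (leqW kd); rewrite /= ltn_eqF.
Qed.

(** Unless the remainder modulo [q ^ d] wraps around, the leading digit stays and the shorter code
    moves one step, backwards if that digit is odd. At a wrap the direction of reading reverses, so
    the shorter word stays and only the leading digit changes. *)
Lemma gray_step d c : c.+1 < q ^ d -> exists2 k, k < d &
  (gray q d c.+1 k = (gray q d c k).+1 \/ gray q d c k = (gray q d c.+1 k).+1) /\
  forall l, l < d -> l != k -> gray q d c.+1 l = gray q d c l.
Proof.
elim: d c => [|d IH] c //= cq.
have Q0 : 0 < q ^ d by rewrite expn_gt0 q_gt0.
rewrite -/(refl d c) -/(refl d c.+1).
have cm := ltn_pmod c Q0.
have [lt|ge] := ltnP (c %% q ^ d).+1 (q ^ d).
  have ed : c.+1 %/ q ^ d = c %/ q ^ d.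
    by rewrite {1}(divn_eq c (q ^ d)) -addnS divnMDl // (divn_small lt) addn0.
  have em : c.+1 %% q ^ d = (c %% q ^ d).+1.
    by rewrite {1}(divn_eq c (q ^ d)) -addnS modnMDl modn_small.
  have [k kd [st nst]] : exists2 k, k < d &
    (gray q d (refl d c.+1) k = (gray q d (refl d c) k).+1 \/
     gray q d (refl d c) k = (gray q d (refl d c.+1) k).+1) /\
    forall l, l < d -> l != k -> gray q d (refl d c.+1) l = gray q d (refl d c) l.
    rewrite /refl ed em; case: odd; last exact: IH.
    have [|k kd [st nst]] := IH ((q ^ d).-1 - (c %% q ^ d).+1); first lia.
    have -> : (q ^ d).-1 - c %% q ^ d = ((q ^ d).-1 - (c %% q ^ d).+1).+1 by lia.
    exists k => //; split; first by case: st; [right|left].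
    by move=> l ld lk; rewrite nst.
  exists k; first exact: ltnW.
  rewrite (ltn_eqF kd); split=> // l; rewrite ltnS leq_eqVlt ed.
  by case: eqP => //= _ ld lk; apply: nst.
have em : c %% q ^ d = (q ^ d).-1 by lia.
have ec : c.+1 = (c %/ q ^ d).+1 * q ^ d.
  by rewrite {1}(divn_eq c (q ^ d)) em mulSn; move: Q0; clear; lia.
exists d => //; rewrite eqxx; split.
  by left; rewrite {1}ec mulnK.
move=> l ld /negPf ->; congr (gray q d _ l).
rewrite /refl {1 2}ec mulnK // {1}ec modnMl em /=.
by case: odd => /=; lia.
Qed.
End Gray.

Local Open Scope ring_scope.

(** * The simplicial boundary as a homomorphism of square zero *)

Section Boundary.
Variable n : nat.
Implicit Types (s t : {set 'I_n}) (v w : 'I_n) (c b z : chain n) (X : {set {set 'I_n}}).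

Definition sgb v t : int :=
  (-1) ^+ #|[set u in t | (nat_of_ord u < nat_of_ord v)%N]|.

Lemma bdE c t : bd c t = \sum_(v | v \notin t) sgb v t * c (v |: t).
Proof. by rewrite ffunE. Qed.

Lemma bd_is_zmod_morphism : zmod_morphism (@bd n).
Proof.
move=> a b; apply/ffunP=> t; rewrite !ffunE -sumrB.
by apply: eq_bigr => v _; rewrite !ffunE mulrBr.
Qed.

HB.instance Definition _ :=
  GRing.isZmodMorphism.Build (chain n) (chain n) (@bd n) bd_is_zmod_morphism.

Lemma sgbU v w t : v \notin t -> sgb w (v |: t) = (-1) ^+ (v < w)%N * sgb w t.
Proof.
move=> vt; rewrite /sgb -exprD; congr (_ ^+ _).
rewrite [LHS](cardD1 v) !inE eqxx /=; congr (_ + _)%N.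
by apply: eq_card => u; rewrite !inE; case: eqP => [->|//]; rewrite (negPf vt).
Qed.

(** Exchanging the two added vertices flips the sign, so the double sum equals its own negative and
    vanishes over the integers. *)
Lemma bd_bd c : bd (bd c) = 0.
Proof.
apply/ffunP=> t; rewrite bdE ffunE.
pose F v w := sgb v t * (sgb w (v |: t) * c (w |: (v |: t))).
have -> : \sum_(v | v \notin t) sgb v t * bd c (v |: t) =
   \sum_(v | v \notin t) \sum_(w | (w \notin t) && (w != v)) F v w.
  apply: eq_bigr => v _; rewrite bdE mulr_sumr.
  by apply: eq_bigl => w; rewrite !inE negb_or andbC.
set S := LHS.
suff SN : S = - S by have := mulrn_eq0 S 2; rewrite mulr2n {1}SN addNr eqxx => /esym/eqP.
rewrite {1}/S (exchange_big_dep (fun v => v \notin t)) /=; last by move=> v w _ /andP[].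
rewrite /S -sumrN; apply: eq_bigr => v vt; rewrite -sumrN.
apply: eq_big => [w|w]; first by rewrite vt eq_sym.
rewrite vt /= => /andP[wt wv]; rewrite /F (setUCA [set v]) !sgbU //.
have : (v : nat) != w by rewrite (inj_eq val_inj).
by case: ltngtP => //= _ _; rewrite ?expr0 ?expr1; ring.
Qed.
End Boundary.

Lemma finZmod_mulrn_card (G : finZmodType) (g : G) : g *+ #|G| = 0.
Proof. by rewrite -FinRing.zmodXgE -cardsT expg_cardG ?inE. Qed.

Definition delta_chain n (t : {set 'I_n}) : chain n := [ffun s : {set 'I_n} => (s == t)%:R].

Lemma bd_neq0 n (c : chain n) t :
  bd c t != 0 -> exists2 v, v \notin t & c (v |: t) != 0.
Proof.
move=> nz; apply/exists_inP; apply: contraNT nz => /exists_inPn H.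
by rewrite bdE big1 // => v /H; rewrite negbK => /eqP->; rewrite mulr0.
Qed.

(** Reads the boundary as a matrix product with entries [bd (delta_chain t) s]; both bounds use this
    form. *)
Lemma bd_delta_sum n (b : chain n) s :
  bd b s = \sum_t b t * bd (delta_chain t) s.
Proof.
under eq_bigr do rewrite bdE mulr_sumr.
rewrite exchange_big bdE /=; apply: eq_bigr => v _.
rewrite (bigD1 (v |: s)) //= big1 => [|t tn]; last first.
  by rewrite ffunE eq_sym (negPf tn) !mulr0.
by rewrite ffunE eqxx addr0 mulr1 mulrC.
Qed.

(** * Cones with apex the vertex 0 *)

Section Cone.
Variable n : nat.
Implicit Types (c z : chain n.+1) (s : {set 'I_n.+1}).

Definition cone c : chain n.+1 :=
  [ffun s : {set 'I_n.+1} => if ord0 \in s then c (s :\ ord0) else 0].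

Lemma sgb0 s : sgb ord0 s = 1.
Proof.
by rewrite /sgb (_ : #|_| = 0%N) ?expr0 //; apply: eq_card0 => u; rewrite !inE andbF.
Qed.

(** Every simplex of the cone contains the apex, so only adding the apex contributes; being the
    least vertex, it has sign 1. *)
Lemma bd_cone c s : ord0 \notin s -> bd (cone c) s = c s.
Proof.
move=> s0; rewrite bdE (bigD1 ord0) //= big1 => [|v /andP[vs v0]].
  by rewrite ffunE setU11 setU1K // sgb0 mul1r addr0.
by rewrite ffunE !inE eq_sym (negPf v0) (negPf s0) mulr0.
Qed.

(** For [s] containing the apex, evaluate the boundary at [s] minus the apex: one term is [z s], the
    others are values of [z] off the apex. *)
Lemma cycle_eq0 z : bd z = 0 -> (forall s, ord0 \notin s -> z s = 0) -> z = 0.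
Proof.
move=> z0 zs; apply/ffunP=> s; rewrite [RHS]ffunE.
have [s0|/zs//] := boolP (ord0 \in s).
have := congr1 (fun c : chain n.+1 => c (s :\ ord0)) z0.
rewrite bdE (bigD1 ord0) ?setD11 //= big1 => [|v /andP[vs v0]].
  by rewrite setD1K // sgb0 mul1r addr0 ffunE.
by rewrite zs ?mulr0 // !inE eqxx eq_sym (negPf v0).
Qed.
End Cone.

(** * Realizing a presentation *)

Section Presentation.
Variables (d n : nat) (G : finZmodType).
Hypothesis d_gt0 : (0 < d)%N.
Variables (F : {set {set 'I_n.+1}}) (I : finType) (ok : pred I)
  (lab : I -> {set 'I_n.+1}) (psi : I -> G).
Hypothesis labP : forall i, ok i -> #|lab i| = d /\ ord0 \notin lab i.
Hypothesis lab_inj : {in ok &, injective lab}.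
Hypothesis FP : forall t, t \in F -> #|t| = d.+1 /\ ord0 \notin t.
(** The next two hypotheses say that the relations among the [psi i] are exactly the boundaries of
    chains on [F], read on the labelled d-sets. *)
Hypothesis rel_psi : forall t, t \in F ->
  \sum_(i | ok i) psi i *~ bd (delta_chain t) (lab i) = 0.
Hypothesis psi_rel : forall c : I -> int, \sum_(i | ok i) psi i *~ c i = 0 ->
  exists2 b : chain n.+1, forall t, b t != 0 -> t \in F &
    forall i, ok i -> bd b (lab i) = c i.
Hypothesis psi_surj : forall g, exists c : I -> int,
  \sum_(i | ok i) psi i *~ c i = g.

Let L : {set {set 'I_n.+1}} := [set lab i | i in ok].
Let X : {set {set 'I_n.+1}} := [set s | (s != set0) &&
  [|| (#|s| <= d)%N, s \in F | [&& #|s| == d.+1, ord0 \in s & s :\ ord0 \notin L]]].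
(** On cycles this induces the isomorphism from the homology of [X] in degree d-1 onto [G]. *)
Let Phi (z : chain n.+1) : G := \sum_(i | ok i) psi i *~ z (lab i).

Let PhiB : zmod_morphism Phi.
Proof.
by move=> y z; rewrite /Phi -sumrB; apply: eq_bigr => i _; rewrite !ffunE mulrzBr.
Qed.
HB.instance Definition _ := GRing.isZmodMorphism.Build (chain n.+1) G Phi PhiB.

Lemma cone_complex : is_complex X.
Proof.
split=> [|s t]; first by rewrite inE eqxx.
rewrite !inE => /andP[s0 sX] ts t0; rewrite t0 /=.
have [->//|tns] := eqVneq t s.
have lts : (#|t| < #|s|)%N by rewrite proper_card // properEneq tns.
suff sd : (#|s| <= d.+1)%N by rewrite -ltnS (leq_trans lts).
case/or3P: sX => [|/FP[-> //]|/and3P[/eqP-> //]].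
exact: leqW.
Qed.

(** A cone simplex has no face in [L]: its base lies outside [L] and its other faces contain the
    apex. So only the part of [b] on [F] counts, and it gives relations. *)
Lemma Phi_bd b : kchain X d b -> Phi (bd b) = 0.
Proof.
move=> bX; pose bF : chain n.+1 := [ffun t : {set 'I_n.+1} => if t \in F then b t else 0].
have -> : Phi (bd b) = Phi (bd bF).
  apply: eq_bigr => i oki; have [ci i0] := labP oki; congr (_ *~ _).
  rewrite !bdE; apply: eq_bigr => v vi; rewrite ffunE; case: ifPn => // vF.
  have [->|/bX[]] := eqVneq (b (v |: lab i)) 0; first by rewrite !mulr0.
  rewrite inE (negPf vF) cardsU1 vi ci add1n ltnn /= => /andP[_].
  case/and3P=> _; rewrite !inE (negPf i0) orbF => /eqP v0.
  by rewrite -v0 setU1K // imset_f.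
rewrite /Phi; under eq_bigr do rewrite bd_delta_sum mulrz_sumr.
rewrite exchange_big big1 //= => t _; rewrite ffunE.
case: ifPn => [tF|_]; last by rewrite big1 // => i _; rewrite mul0r.
by under eq_bigr do rewrite mulrC mulrzA; rewrite -mulrz_suml rel_psi ?mul0rz.
Qed.

(** A chain on [F] matches [z] on [L], and cones absorb the difference outside [L]. What remains is
    a cycle vanishing off the apex, hence zero. *)
Lemma Phi_kboundary z : kcycle X d.-1 z -> Phi z = 0 -> kboundary X d.-1 z.
Proof.
case=> zX bz /psi_rel[b bF bz_lab]; rewrite /kchain prednK // in zX.
pose e : chain n.+1 := [ffun s : {set 'I_n.+1} =>
  if [&& #|s| == d, ord0 \notin s & s \notin L] then z s - bd b s else 0].
exists (b + cone e); rewrite prednK //; split=> [s|].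
  rewrite inE !ffunE.
  have [/bF sF _|/negPn/eqP->] := boolP (b s != 0).
    have [cs _] := FP sF; split; last exact: cs.
    by rewrite sF -card_gt0 cs orbT.
  rewrite add0r; case: ifP => [s0|_]; last by rewrite eqxx.
  case: ifP => [/and3P[/eqP cs _ sL] _|_]; last by rewrite eqxx.
  have cs1 : #|s| = d.+1 by rewrite (cardsD1 ord0) s0 cs.
  by split=> //; rewrite -card_gt0 sL cs1 ltnn eqxx !orbT.
apply/eqP; rewrite -subr_eq0; apply/eqP/cycle_eq0 => [|s s0].
  by rewrite raddfB /= bd_bd bz subrr.
have -> : (z - bd (b + cone e)) s = z s - bd b s - e s.
  by rewrite raddfD /= 3!ffunE (bd_cone _ s0) ffunE opprD addrA.
rewrite [e s]ffunE s0 /=; case: ifPn => [_|]; first by rewrite subrr.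
rewrite subr0; have [sd /= |sd _] := eqVneq #|s| d.
  by rewrite negbK => /imsetP[i oki ->]; rewrite bz_lab ?subrr.
have -> : z s = 0 by apply: contraNeq sd => /zX[_ ->].
rewrite sub0r; apply/eqP; rewrite oppr_eq0; apply: contraNT sd.
by case/bd_neq0=> v vs /bF/FP[]; rewrite cardsU1 vs add1n => /eqP; rewrite eqSS.
Qed.

Lemma presentation_realizable : realizable d G n.+1.
Proof.
exists X; split; first exact: cone_complex.
have [c cE] := fin_all_exists psi_surj.
(* Lift [g] to an integer combination of labelled d-sets. The cone over it does not use simplices of
   [X], but its boundary is a cycle in the full (d-1)-skeleton. *)
pose cL g : chain n.+1 := [ffun s : {set 'I_n.+1} => \sum_(i | ok i && (lab i == s)) c g i].
pose f g := bd (cone (cL g)).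
have Phif g : Phi (f g) = g.
  rewrite -[RHS]cE; apply: eq_bigr => i oki; have [_ i0] := labP oki.
  rewrite /f bd_cone // ffunE (bigD1 i) ?oki ?eqxx //= big1 ?addr0 // => j.
  by case/andP=> /andP[okj /eqP eji]; rewrite (lab_inj okj oki eji) eqxx.
have f_cyc g : kcycle X d.-1 (f g).
  split=> [s /bd_neq0[v vs]|]; last exact: bd_bd.
  rewrite ffunE; case: ifP => [v0|_]; last by rewrite eqxx.
  rewrite ffunE; have [i /andP[oki /eqP ei]|no] :=
      pickP (fun i => ok i && (lab i == (v |: s) :\ ord0)).
    move=> _; have [ci _] := labP oki.
    have cs : #|s| = d.
      have := cardsU1 v s; rewrite vs (cardsD1 ord0) v0 -ei ci.
      by rewrite add1n => -[].
    by rewrite inE prednK // -card_gt0 cs d_gt0 leqnn.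
  by rewrite big_pred0 ?eqxx.
have kcB y z : kcycle X d.-1 y -> kcycle X d.-1 z -> kcycle X d.-1 (y - z).
  move=> [yX y0] [zX z0]; split; last by rewrite raddfB /= y0 z0 subrr.
  move=> s; rewrite !ffunE; have [/eqP ys|/yX//] := boolP (y s == 0).
  by rewrite ys sub0r oppr_eq0; exact: zX.
have kcMn y m : kcycle X d.-1 y -> kcycle X d.-1 (y *+ m).
  move=> [yX y0]; split; last by rewrite raddfMn /= y0 mul0rn.
  by move=> s; rewrite ffunMnE mulrn_eq0 negb_or => /andP[_ /yX].
exists f; split=> [g|g h|g|z [zc _]].
(* The order of [G] serves as the torsion exponent, since [Phi] detects boundaries. *)
- split=> //; exists #|G|; split; first by apply/card_gt0P; exists 0.
  by apply: Phi_kboundary; rewrite ?raddfMn /= ?Phif ?finZmod_mulrn_card //; apply: kcMn.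
- apply: Phi_kboundary; first by apply: (kcB) => //; apply: (kcB).
  by rewrite !raddfB /= !Phif addrAC addrK subrr.
- by case=> b [bX fb]; rewrite -(Phif g) fb Phi_bd // -[d]prednK.
- exists (Phi z); apply: Phi_kboundary; first exact: kcB.
  by rewrite raddfB /= Phif subrr.
Qed.
End Presentation.

(** * Subgroups as predicates, for computing with congruences *)

Section Subgroup.
Variables (V : zmodType) (K : V -> Prop).

Definition subgroup := K 0 /\ forall a b, K a -> K b -> K (a - b).

Hypothesis sK : subgroup.

Lemma subgroupN a : K a -> K (- a).
Proof. by move=> Ka; rewrite -sub0r; apply: sK.2 => //; apply: sK.1. Qed.

Lemma subgroupD a b : K a -> K b -> K (a + b).
Proof. by move=> Ka Kb; rewrite -[b]opprK; apply: sK.2 => //; apply: subgroupN. Qed.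

Lemma subgroup_sum (I : finType) (P : pred I) (f : I -> V) :
  (forall i, P i -> K (f i)) -> K (\sum_(i | P i) f i).
Proof. move=> Kf; elim/big_ind: _ => //; [exact: sK.1 | exact: subgroupD]. Qed.

Lemma subgroupMz a (m : int) : K a -> K (a *~ m).
Proof.
move=> Ka; have KMn k : K (a *+ k).
  elim: k => [|k IH]; first by rewrite mulr0n; exact: sK.1.
  by rewrite mulrSr; apply: subgroupD.
by case: m => k; [exact: KMn | apply/subgroupN/KMn].
Qed.
End Subgroup.

(** * The multipartite grid *)

Section Multipartite.
Variables d W : nat.
Implicit Types (p k : 'I_d.+1) (q : 'I_d.+1 -> 'I_W).

(* Vertex [r] of part [p]; vertex 0 is left out for the cone point. *)
Definition vert p (r : 'I_W) : 'I_(d.+1 * W).+1 := inord (p * W + r).+1.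

Lemma vertE p r : vert p r = (p * W + r).+1 :> nat.
Proof.
rewrite inordK // ltnS (@leq_trans (p.+1 * W)) ?leq_mul2r ?ltn_ord ?orbT //.
by rewrite mulSn addnC ltn_add2r.
Qed.

Lemma vert_inj p p' r r' : vert p r = vert p' r' -> p = p' /\ r = r'.
Proof.
move/(congr1 (@nat_of_ord _)); rewrite !vertE => -[e].
have W0 : (0 < W)%N by apply: leq_ltn_trans (ltn_ord r).
have ep : p = p' :> nat.
  have := congr1 (fun m => m %/ W)%N e.
  by rewrite !divnMDl // !divn_small ?addn0.
split; apply: val_inj => //=.
by move: e; rewrite ep => /addnI.
Qed.

Lemma vert_lt p k r r' : (p < k)%N -> (vert p r < vert k r')%N.
Proof.
move=> pk; rewrite !vertE ltnS (@leq_trans (p.+1 * W)) //.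
  by rewrite mulSn addnC ltn_add2r.
by rewrite (leq_trans _ (leq_addr _ _)) // leq_mul2r pk orbT.
Qed.

Definition vset q : {set 'I_(d.+1 * W).+1} := [set vert p (q p) | p : 'I_d.+1].
(** In the grid picture, [vset q] is a point and this face is the line in direction [p] through
    it. *)
Definition face p q := vset q :\ vert p (q p).

Lemma vert_vset_inj q : injective (fun p => vert p (q p)).
Proof. by move=> p k /vert_inj[]. Qed.

Lemma mem_vset p r q : (vert p r \in vset q) = (r == q p).
Proof.
apply/imsetP/eqP => [[k _ /vert_inj[-> ->]]//|->]; by exists p.
Qed.

Lemma mem_face p r k q : (vert p r \in face k q) = (p != k) && (r == q p).
Proof.
rewrite in_setD1 mem_vset; case: (r =P q p) => [->|]; last by rewrite !andbF.
rewrite !andbT; congr (~~ _); apply/eqP/eqP => [/vert_inj[]//|->//].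
Qed.

Lemma ord0_vset q : ord0 \notin vset q.
Proof.
by apply/imsetP=> -[p _ /(congr1 (@nat_of_ord _))]; rewrite vertE.
Qed.

Lemma card_vset q : #|vset q| = d.+1.
Proof. by rewrite card_imset ?card_ord //; apply: vert_vset_inj. Qed.

Lemma card_face p q : #|face p q| = d.
Proof.
by have := card_vset q; rewrite (cardsD1 (vert p (q p))) mem_vset eqxx add1n => -[].
Qed.

Lemma ord0_face p q : ord0 \notin face p q.
Proof. by rewrite !inE negb_and ord0_vset orbT. Qed.

Lemma face_eqP p q p' q' :
  face p q = face p' q' <-> p = p' /\ forall k, k != p -> q k = q' k.
Proof.
split=> [e|[-> e]].
  have ep : p = p'.
    apply/eqP/negPn/negP => np; have := mem_face p (q' p) p' q'.
    by rewrite -e mem_face eqxx np eqxx.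
  split=> // k kp; have := mem_face k (q k) p q.
  by rewrite e mem_face -ep kp eqxx /= => /eqP.
apply/setP=> v; rewrite !in_setD1.
apply/andP/andP => -[nv /imsetP[k _ ek]]; move: nv; rewrite ek => nv;
  have kp : k != p' by [apply: contraNneq nv => ->];
  rewrite mem_vset (e k) // eqxx; split=> //;
  by apply: contraNneq kp => /vert_inj[-> _].
Qed.

(** The parts occupy consecutive intervals of vertices, so exactly the [p] chosen vertices of the
    earlier parts precede. *)
Lemma sgb_vert p q : sgb (vert p (q p)) (face p q) = (-1) ^+ p.
Proof.
rewrite /sgb; congr (_ ^+ _).
have -> : [set u in face p q | (u < vert p (q p))%N]
    = [set vert k (q k) | k : 'I_d.+1 & (k < p)%N].
  apply/setP=> v; rewrite !inE; apply/idP/imsetP => [/andP[/andP[vp /imsetP[k _ ek]] lt]|].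
    exists k => //; rewrite inE ltnNge leq_eqVlt negb_or.
    move: vp lt; rewrite ek => vp lt; apply/andP; split.
      by apply: contraNneq vp => /val_inj->.
    by apply/negP => /(vert_lt (q p) (q k))/ltnW; rewrite leqNgt lt.
  case=> k; rewrite inE => kp ->; rewrite mem_vset eqxx vert_lt // !andbT.
  by apply: contraTneq kp => /vert_inj[-> _]; rewrite ltnn.
rewrite card_imset; last exact: vert_vset_inj.
rewrite cardsE -sum1_card (big_ord_narrow (ltnW (ltn_ord p))) /=.
by rewrite sum_nat_const card_ord muln1.
Qed.

(** The sign depends on the direction alone, so one change of sign per direction turns all relations
    into plain sums. *)
Lemma incidence p q q' :
  bd (delta_chain (vset q)) (face p q')
  = if face p q' == face p q then (-1) ^+ p else 0.
Proof.
rewrite bdE; case: ifPn => [/eqP e|ne].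
  rewrite e (bigD1 (vert p (q p))) ?mem_face ?eqxx //= sgb_vert ffunE.
  rewrite setD1K ?mem_vset ?eqxx // mulr1 big1 ?addr0 // => v /andP[vf vp].
  rewrite ffunE; case: eqP => [ve|]; last by rewrite mulr0.
  have /imsetP[k _ ek] : v \in vset q by rewrite -ve setU11.
  by move: vf vp; rewrite ek mem_face eqxx andbT negbK => /eqP->; rewrite eqxx.
rewrite big1 // => v vf; rewrite ffunE; case: eqP => [ve|]; last by rewrite mulr0.
have /imsetP[k _ ek] : v \in vset q by rewrite -ve setU11.
have e : face k q = face p q' by rewrite /face -ek -ve setU1K.
by have [ekp _] := (face_eqP _ _ _ _).1 e; move: ne; rewrite -e ekp eqxx.
Qed.
End Multipartite.

(* Site [s] carries the line [X_s] in direction 0 through [pos s] and, for each move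
   [rel s j = Some t], the line [Y_(s,j)] in direction [j+1] through the point
   [(u s, pos s)].  The points [(u s, pos s)] and [(u s, pos t)] then give
   [X_s + \sum_j Y_(s,j) = 0] and [X_t + Y_(s,j) = 0].  Dead sites have [X_s = 0]. *)
Section Grid.
Variables (d W : nat) (G : finZmodType) (S : finType).
Hypothesis d_gt0 : (0 < d)%N.
Variables (pos : S -> 'I_d -> 'I_W) (u : S -> 'I_W) (base live : pred S)
  (rel : S -> 'I_d -> option S) (psi : S -> G).
Hypothesis pos_inj : forall s t, (forall k, pos s k = pos t k) -> s = t.
Hypothesis rel_pos : forall s j t, base s -> rel s j = Some t ->
  forall k, k != j -> pos t k = pos s k.
(** This and [u_move] ensure that no auxiliary line passes through a point of the construction other
    than by design. *)
Hypothesis u_line : forall s t k, u s = u t ->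
  (forall l, l != k -> pos s l = pos t l) -> s = t.
Hypothesis u_move : forall s t j s' k, base s -> rel s j = Some t -> k != j ->
  u s' = u s -> (forall l, l != k -> pos s' l = pos t l) -> False.
Hypothesis rel_live : forall s j t, base s -> rel s j = Some t -> live t.
Hypothesis psi_dead : forall s, ~~ live s -> psi s = 0.
Hypothesis psi_base : forall s, base s -> psi s = \sum_j oapp psi 0 (rel s j).
(* The sites generate, subject to these relations, a group mapped injectively to
   [G]; the quotient is expressed by congruence modulo a subgroup [K] of [V]. *)
Hypothesis psi_pres : forall (V : zmodType) (K : V -> Prop) (x : S -> V),
  subgroup K -> (forall s, ~~ live s -> x s = 0) ->
  (forall s, base s -> K (x s - \sum_j oapp x 0 (rel s j))) ->
  forall (J : finType) (f : J -> S) (c : J -> int),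
    \sum_j psi (f j) *~ c j = 0 -> K (\sum_j x (f j) *~ c j).
Hypothesis psi_surj : forall g, exists c : S -> int, \sum_s psi s *~ c s = g.

Let pt (a : 'I_W) (s : S) : 'I_d.+1 -> 'I_W :=
  fun p => oapp (pos s) a (unlift ord0 p).

Let pt0 a s : pt a s ord0 = a.
Proof. by rewrite /pt unlift_none. Qed.

Let ptS a s j : pt a s (lift ord0 j) = pos s j.
Proof. by rewrite /pt liftK. Qed.

Let I : Type := (S + S * 'I_d)%type.

Let ok (i : I) := match i with
  | inl s => live s
  | inr (s, j) => base s && rel s j
  end.

Let lab (i : I) := match i with
  | inl s => face ord0 (pt (u s) s)
  | inr (s, j) => face (lift ord0 j) (pt (u s) s)
  end.

Let sg (j : 'I_d) : int := (-1) ^+ (lift ord0 j).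

(** The value on an auxiliary line is forced by the relation [X_t + sg j Y_(s,j) = 0]. *)
Let psiI (i : I) : G := match i with
  | inl s => psi s
  | inr (s, j) => - (oapp psi 0 (rel s j) *~ sg j)
  end.

Let F : {set {set 'I_(d.+1 * W).+1}} :=
  [set vset (pt (u s) s) | s in base] :|:
  [set vset (pt (u sj.1) (odflt sj.1 (rel sj.1 sj.2))) |
    sj : S * 'I_d & base sj.1 && rel sj.1 sj.2].

Let FP t : t \in F -> exists2 s, base s &
   t = vset (pt (u s) s) \/ exists j s1, rel s j = Some s1 /\ t = vset (pt (u s) s1).
Proof.
case/setUP=> /imsetP; first by case=> s bs ->; exists s; rewrite //; left.
case=> -[s j]; rewrite inE /= => /andP[bs]; case e: (rel s j) => [s1|//] _ ->.
by exists s => //; right; exists j, s1.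
Qed.

Let F_base s : base s -> vset (pt (u s) s) \in F.
Proof. by move=> bs; apply/setUP; left; apply: imset_f. Qed.

Let F_rel s j s1 : base s -> rel s j = Some s1 -> vset (pt (u s) s1) \in F.
Proof.
move=> bs e; apply/setUP; right; apply/imsetP; exists (s, j) => /=.
  by rewrite inE /= bs e.
by rewrite e.
Qed.

Let face0P s a t : (lab (inl s) == face ord0 (pt a t)) = (s == t).
Proof.
apply/eqP/eqP => [/face_eqP[_ e]|->].
  by apply: pos_inj => k; rewrite -!(ptS a) -e ?ptS.
apply/face_eqP; split=> // k; have [j ->|->] := unliftP ord0 k; last by rewrite eqxx.
by rewrite !ptS.
Qed.

Let faceSP s j a t : reflect (u s = a /\ forall l, l != j -> pos s l = pos t l)
  (lab (inr (s, j)) == face (lift ord0 j) (pt a t)).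
Proof.
apply: (iffP eqP) => [/face_eqP[_ e]|[ua e]].
  split; first by have := e ord0; rewrite !pt0; apply; rewrite neq_lift.
  move=> l lj; have := e (lift ord0 l); rewrite !ptS; apply.
  by rewrite (inj_eq (@lift_inj _ ord0)).
apply/face_eqP; split=> // k; have [l ->|-> _] := unliftP ord0 k; last by rewrite !pt0.
by rewrite (inj_eq (@lift_inj _ ord0)) !ptS; apply: e.
Qed.

Let sum_inc (V : zmodType) (h : I -> V) a t :
  \sum_(i | ok i) h i *~ bd (delta_chain (vset (pt a t))) (lab i) =
  (if live t then h (inl t) else 0) +
  \sum_s \sum_(j | ok (inr (s, j)) &&
     (lab (inr (s, j)) == face (lift ord0 j) (pt a t))) h (inr (s, j)) *~ sg j.
Proof.
rewrite big_sumType /=; congr (_ + _).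
  rewrite big_mkcond (bigD1 t) //= big1 ?addr0 => [|s st].
    case: ifP => // lt; rewrite incidence ifT ?expr0 ?mulr1z //.
    by have := face0P t a t; rewrite /lab eqxx.
  case: ifP => // lt; rewrite incidence; have := face0P s a t; rewrite /lab => ->.
  by rewrite (negPf st) mulr0z.
transitivity (\sum_s \sum_j if ok (inr (s, j)) then
  h (inr (s, j)) *~ bd (delta_chain (vset (pt a t))) (lab (inr (s, j))) else 0).
  by rewrite pair_bigA big_mkcond /=; apply: eq_bigr => -[].
apply: eq_bigr => s _; rewrite [RHS]big_mkcond; apply: eq_bigr => j _.
rewrite /= incidence; case: ifP => _ //=.
by case: ifP; rewrite ?mulr0z.
Qed.

(** By [u_line], the auxiliary lines through the point over [pos s] at level [u s] are those of [s]
    alone. *)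
Let sum_base (V : zmodType) (h : I -> V) s : base s ->
  \sum_(i | ok i) h i *~ bd (delta_chain (vset (pt (u s) s))) (lab i) =
  (if live s then h (inl s) else 0) + \sum_(j | rel s j) h (inr (s, j)) *~ sg j.
Proof.
move=> bs; rewrite sum_inc; congr (_ + _).
rewrite (bigD1 s) //= [X in _ + X]big1 ?addr0 => [|t ts].
  by apply: eq_bigl => j; rewrite bs /= eqxx andbT.
apply: big_pred0 => j; apply/negP=> /andP[_ /faceSP[ut e]].
by move: ts; rewrite (u_line ut e) eqxx.
Qed.

(** Lines in directions other than that of [j] are excluded by [u_move]. In that direction the point
    lies on the line of [s], and [u_line] excludes other sites. *)
Let sum_rel (V : zmodType) (h : I -> V) s j t : base s -> rel s j = Some t ->
  \sum_(i | ok i) h i *~ bd (delta_chain (vset (pt (u s) t))) (lab i) =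
  h (inl t) + h (inr (s, j)) *~ sg j.
Proof.
move=> bs st; rewrite sum_inc (rel_live bs st); congr (_ + _).
have key s' j' : u s' = u s -> (forall l, l != j' -> pos s' l = pos t l) ->
    j' = j /\ s' = s.
  move=> us e; have ej : j' = j.
    by apply/eqP/negPn/negP => nj; apply: u_move bs st nj us e.
  split=> //; apply: (u_line (k := j) us) => l lj.
  by rewrite e ?ej // (rel_pos bs st).
rewrite (bigD1 s) //= [X in _ + X]big1 ?addr0 => [|s' ss]; last first.
  apply: big_pred0 => j'; apply/negP=> /andP[_ /faceSP[us e]].
  by have [_ es] := key _ _ us e; rewrite es eqxx in ss.
rewrite (big_pred1 j) // => j'; apply/andP/eqP => [[_ /faceSP[us e]]|->].
  by have [] := key _ _ us e.
by rewrite bs st; split=> //; apply/faceSP; split=> // l lj; rewrite (rel_pos bs st).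
Qed.

Lemma grid_realizable : realizable d G (d.+1 * W).+1.
Proof.
apply: (@presentation_realizable d _ G d_gt0 F I ok lab psiI).
- by case=> [s|[s j]] _; rewrite card_face ord0_face.
- move=> [s|[s j]] [t|[t k]] oi oj /=.
  + by move/eqP; have := face0P s (u t) t; rewrite /lab => -> /eqP->.
  + by case/face_eqP=> /(congr1 val).
  + by case/face_eqP=> /(congr1 val).
  + move=> e; have [ejk _] := (face_eqP _ _ _ _).1 e; move/lift_inj: ejk => ejk.
    subst k; have /faceSP[ust e'] : lab (inr (s, j)) == face (lift ord0 j) (pt (u t) t).
      by apply/eqP.
    by rewrite (u_line ust e').
- by move=> t /FP[s _ [->|[j [s1 [_ ->]]]]]; rewrite card_vset ord0_vset.
- have sgK j : sg j * sg j = 1 by rewrite -expr2 sqrr_sign.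
  move=> t /FP[s bs [->|[j [s1 [e ->]]]]].
    rewrite sum_base //= (_ : (if _ then _ else _) = psi s); last first.
      by case: ifPn => // /psi_dead.
    rewrite psi_base // [X in X + _](bigID (fun j => isSome (rel s j))) /=.
    rewrite [X in _ + X + _]big1 ?addr0 => [|j]; last by case: (rel s j).
    rewrite -big_split big1 //= => j _.
    by rewrite mulNrz -mulrzA sgK mulr1z subrr.
  by rewrite (sum_rel _ bs e) /= e /= mulNrz -mulrzA sgK mulr1z subrr.
- have sgK j : sg j * sg j = 1 by rewrite -expr2 sqrr_sign.
  (* Apply [psi_pres] with [V] the free abelian group on [I] and [K] the vectors that agree on [ok]
     indices with the boundary of a chain on [F]. *)
  move=> c c0; pose V : zmodType := {ffun I -> int}.
  pose dl (i : I) : V := [ffun j => (j == i)%:R].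
  pose K (v : V) := exists2 b : chain (d.+1 * W).+1,
    (forall t, b t != 0 -> t \in F) & forall i, ok i -> bd b (lab i) = v i.
  have sK : subgroup K.
    split; first by exists 0 => [t|i _]; rewrite ?raddf0 ffunE ?eqxx ?ffunE.
    move=> y z [b bF by_] [b' bF' bz]; exists (b - b') => [t|i oi].
      rewrite !ffunE; have [->|/bF//] := eqVneq (b t) 0.
      by rewrite sub0r oppr_eq0 => /bF'.
    by rewrite raddfB /= [RHS]ffunE [X in _ = _ + X]ffunE -by_ // -bz // !ffunE.
  have KF t : t \in F -> K (\sum_(i | ok i) dl i *~ bd (delta_chain t) (lab i)).
    move=> tF; exists (delta_chain t) => [t'|i oi].
      by rewrite ffunE; case: (t' =P t) => [->|]; rewrite ?eqxx.
    rewrite sum_ffunE (bigD1 i) //= big1 ?addr0 => [|j /andP[_ ji]].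
      by rewrite ffunMzE [dl i i]ffunE eqxx intz.
    by rewrite ffunMzE [dl j i]ffunE eq_sym (negPf ji) mul0rz.
  pose x (s : S) : V := if live s then dl (inl s) else 0.
  have Krel s j t : base s -> rel s j = Some t -> K (x t + dl (inr (s, j)) *~ sg j).
    move=> bs e; have := KF _ (F_rel bs e); rewrite (sum_rel _ bs e) /x.
    by rewrite (rel_live bs e).
  have Kbase s : base s -> K (x s - \sum_j oapp x 0 (rel s j)).
    move=> bs; have := KF _ (F_base bs); rewrite sum_base // -/(x s) => Ks.
    have -> : x s - \sum_j oapp x 0 (rel s j) =
       x s + \sum_(j | rel s j) dl (inr (s, j)) *~ sg j -
       \sum_(j | rel s j) (oapp x 0 (rel s j) + dl (inr (s, j)) *~ sg j).
      rewrite big_split /= opprD addrACA subrr addr0; congr (_ - _).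
      rewrite [LHS](bigID (fun j => isSome (rel s j))) /= addrC big1 ?add0r //.
      by move=> j; case: (rel s j).
    apply: sK.2 => //; apply: subgroup_sum => // j.
    by case e: (rel s j) => [t|//] _; apply: Krel.
  (* Eliminate each auxiliary generator: modulo [K], [Y_(s,j)] is [- sg j] times the generator at
     the target [t]. A combination of sites remains. *)
  pose f (i : I) := match i with inl s => s | inr (s, j) => odflt s (rel s j) end.
  pose c' (i : I) := if ok i then
    match i with inl s => c i | inr (s, j) => - (sg j * c i) end else 0.
  have Kx : K (\sum_i x (f i) *~ c' i).
    apply: (psi_pres sK _ Kbase) => [s /negPf ls|]; first by rewrite /x ls.
    rewrite -[RHS]c0 [RHS]big_mkcond; apply: eq_bigr => i _; rewrite /c'.
    case: ifP => oi; last by rewrite mulr0z.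
    case: i oi => [s|[s j]] //= /andP[bs]; case: (rel s j) => //= t _.
    by rewrite mulrNz mulNrz mulrzA.
  have Kc : K (\sum_(i | ok i) dl i *~ c i).
    have ex : \sum_i x (f i) *~ c' i = \sum_(i | ok i) x (f i) *~ c' i.
      rewrite [RHS]big_mkcond; apply: eq_bigr => i _; rewrite /c'.
      by case: (ok i); rewrite ?mulr0z.
    have -> : \sum_(i | ok i) dl i *~ c i = \sum_i x (f i) *~ c' i +
        \sum_(i | ok i) (dl i *~ c i - x (f i) *~ c' i).
      by rewrite sumrB ex addrC subrK.
    apply: subgroupD => //; apply: subgroup_sum => // i oi; rewrite /c' oi.
    case: i oi => [s|[s j]] /=; first by move=> ls; rewrite /x ls subrr; exact: sK.1.
    case/andP=> bs; case e: (rel s j) => [t|//] _ /=.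
    have := subgroupMz sK (sg j * c (inr (s, j))) (Krel _ _ _ bs e).
    by rewrite mulrzDl -[_ *~ sg j *~ _]mulrzA mulrA sgK mul1r mulrNz opprK addrC.
  have [b bF bK] := Kc; exists b => // i oi; rewrite bK // sum_ffunE (bigD1 i) //=.
  rewrite big1 ?addr0 => [|j /andP[_ ji]]; first by rewrite ffunMzE [dl i i]ffunE eqxx intz.
  by rewrite ffunMzE [dl j i]ffunE eq_sym (negPf ji) mul0rz.
- move=> g; have [c cg] := psi_surj g.
  exists (fun i => if i is inl s then c s else 0).
  rewrite big_sumType /= [X in _ + X]big1 ?addr0; last by case=> s j; rewrite mulr0z.
  rewrite -cg [RHS](bigID live) /= [X in _ = _ + X]big1 ?addr0 // => s /psi_dead->.
  by rewrite mul0rz.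
Qed.
End Grid.

(** * Horner's scheme along a Gray code *)

(* Cell [c] multiplies the current multiple [w c] of its generator [e] by 2 and adds
   [bit c] times [e].  It uses a 2 x 3 array of sites (row, column), the columns
   [None, Some false, Some true] being numbered 0, 1, 2:
     E  = e        P  = w e   C1 = w e
     Wt = 2w e+b e C2 = w e   D  = 2w e
   The roles of the first two coordinates are exchanged in odd cells, so that the
   input [P] lies at the local position of the output [Wt] of the previous cell. *)
Section Program.
Variables (d q N r : nat) (G : finZmodType).
Hypothesis d_gt1 : (1 < d)%N.
Hypothesis q_gt0 : (0 < q)%N.
Hypothesis NQ : (N < q ^ d)%N.
Variables (g : 'I_r -> G) (m start : 'I_r -> nat).
Variables (comp : nat -> 'I_r) (w : nat -> nat) (bit st en : nat -> bool).
Hypothesis g_gen : forall h, exists a : 'I_r -> int, \sum_i g i *~ a i = h.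
Hypothesis g_free : forall a : 'I_r -> int, \sum_i g i *~ a i = 0 ->
  forall i, exists b, a i = (m i)%:Z * b.
Hypothesis g_order : forall i, g i *+ m i = 0.
Hypothesis startP : forall i, [/\ (start i <= N)%N, st (start i) & comp (start i) = i].
Hypothesis st_start : forall c, (c <= N)%N -> st c -> c = start (comp c) /\ w c = 1%N.
Hypothesis st_step : forall c, (c <= N)%N -> ~~ st c -> [/\ (0 < c)%N,
  comp c = comp c.-1, w c = ((w c.-1).*2 + bit c.-1)%N & ~~ en c.-1].
Hypothesis enP : forall c, (c <= N)%N -> en c -> ((w c).*2 + bit c)%N = m (comp c).
Hypothesis en_ex : forall i, exists c, [/\ (c <= N)%N, en c & comp c = i].

Let S : Type := ('I_N.+1 * (bool * option bool))%type.
Let E c : S := (c, (false, None)).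
Let P c : S := (c, (false, Some false)).
Let C1 c : S := (c, (false, Some true)).
Let C2 c : S := (c, (true, Some false)).
Let D c : S := (c, (true, Some true)).
Let Wt c : S := (c, (true, None)).

Let weight (s : S) : nat := let: (c, (i, j)) := s in
  match i, j with
  | false, None => 1
  | true, None => (w c).*2 + bit c
  | true, Some true => (w c).*2
  | _, _ => w c
  end.

Let k0 : 'I_d := Ordinal (ltnW d_gt1).
Let k1 : 'I_d := Ordinal d_gt1.
Let rowk (c : nat) := if odd c then k1 else k0.
Let colk (c : nat) := if odd c then k0 else k1.
Let prev (c : 'I_N.+1) : 'I_N.+1 := inord c.-1.
Let gr (c : nat) (k : 'I_d) := gray q d c k.
(** [dir c] is the coordinate in which the words of [c.-1] and [c] differ. The default in [dir] is
    taken only at cell 0, which is a start cell. *)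
Let adj (c : nat) (k : 'I_d) :=
  ((gr c k == (gr c.-1 k).+1) || (gr c.-1 k == (gr c k).+1)) &&
  [forall l, (l != k) ==> (gr c l == gr c.-1 l)].
Let dir (c : nat) : 'I_d := odflt k0 [pick k | adj c k].

Let rel (s : S) (k : 'I_d) : option S := let: (c, (i, j)) := s in
  match i, j with
  | false, None => if k == dir c then Some (E (prev c)) else None
  | false, Some false =>
    if st c then if k == colk c then Some (E c) else None
    else if k == dir c then Some (Wt (prev c)) else None
  | false, Some true => if k == colk c then Some (P c) else None
  | true, Some false => if k == rowk c then Some (P c) else None
  | true, Some true => if k == colk c then Some (C2 c) else
      if k == rowk c then Some (C1 c) else None
  | true, None => if k == colk c then Some (D c) else
      if k == rowk c then if bit c then Some (E c) else None else None
  end.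

(** The site [E] of a start cell carries no relation, being a free generator. Omitting the line at
    [Wt] of an end cell imposes [m e = 0]. *)
Let base (s : S) : bool := ~~ (st s.1 && (s.2 == (false, None))).
Let live (s : S) : bool := ~~ (en s.1 && (s.2 == (true, None))).
Let psi (s : S) : G := g (comp s.1) *+ weight s.

Let colv (j : option bool) : nat := oapp (fun b : bool => b.+1) 0%N j.
(** The Gray word of the cell picks a block of side 3; row and column are offsets inside it. *)
Let posn (s : S) (k : 'I_d) : nat :=
  (3 * gr s.1 k + (if k == rowk s.1 then nat_of_bool s.2.1
                   else if k == colk s.1 then colv s.2.2 else 0))%N.

Let colv_lt j : (colv j < 3)%N. Proof. by case: j => [[]|]. Qed.

Let row_col c : rowk c != colk c.
Proof. by rewrite /rowk /colk; case: odd. Qed.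

Let posn_lt s k : (posn s k < 3 * q)%N.
Proof.
have := gray_lt q_gt0 k (leq_trans (ltn_ord s.1) NQ); rewrite /posn -/(gr s.1 k).
have := colv_lt s.2.2; case: ifP => _; last by case: ifP => _; lia.
by case: s.2.1 => /=; lia.
Qed.

Let posn_inj s t : (forall k, posn s k = posn t k) -> s = t.
Proof.
case: s t => [c [i j]] [c' [i' j']] e.
have loc_lt (s : S) k : ((if k == rowk s.1 then nat_of_bool s.2.1
                   else if k == colk s.1 then colv s.2.2 else 0) < 3)%N.
  by case: ifP => _; [case: s.2.1 | case: ifP => // _; apply: colv_lt].
have ec : c = c'.
  apply/val_inj/(gray_inj q_gt0 (leq_trans (ltn_ord c) NQ) (leq_trans (ltn_ord c') NQ)).
  move=> k kd; have := e (Ordinal kd); rewrite /posn /gr /=.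
  have := loc_lt (c, (i, j)) (Ordinal kd); have := loc_lt (c', (i', j')) (Ordinal kd).
  by move=> /=; lia.
subst c'; have := e (rowk c); have := e (colk c); rewrite /posn /= !eqxx.
rewrite eq_sym (negPf (row_col c)) => /addnI ej /addnI ei.
by congr (_, (_, _)); [case: i i' ei {e} => -[] | case: j j' ej {e} => [[]|] [[]|]].
Qed.

Let dirP (c : nat) : (0 < c <= N)%N -> adj c (dir c).
Proof.
case: c => // c cN; rewrite /dir; case: pickP => //= no.
have [k kd [ek el]] := gray_step q_gt0 (leq_ltn_trans cN NQ).
have := no (Ordinal kd); rewrite /adj /gr /=.
have -> : [forall l, (l != Ordinal kd) ==> (gray q d c.+1 l == gray q d c l)].
  by apply/forallP=> l; apply/implyP=> lk; rewrite el.
by case: ek => ->; rewrite eqxx ?orbT.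
Qed.

Let prevE (c : 'I_N.+1) : prev c = c.-1 :> nat.
Proof. by rewrite inordK // (leq_ltn_trans (leq_pred _)). Qed.

Let cN (c : 'I_N.+1) : (c <= N)%N. Proof. by rewrite -ltnS. Qed.

(** A move inside a cell changes one offset by 1 or 2. A move between cells keeps the offsets, as
    row and column trade places, and shifts the block by 3 along [dir c]. None of these shifts is 0
    modulo 6. *)
Let rel_geom s j t : base s -> rel s j = Some t ->
  (posn s j != posn t j %[mod 6])%N /\ forall k, k != j -> posn t k = posn s k.
Proof.
have rc := row_col; case: s => [c [i o]].
have intra i' o' k :
   (k == rowk c) && (o == o') && (i != i') || (k == colk c) && (i == i') && (o != o') ->
   (posn (c, (i, o)) k != posn (c, (i', o')) k %[mod 6])%N /\
   forall l, l != k -> posn (c, (i', o')) l = posn (c, (i, o)) l.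
  case/orP=> /andP[/andP[/eqP-> /eqP->] ne]; rewrite /posn /=.
    split; last by move=> l /negPf->.
    by rewrite eqxx; case: i i' ne => -[] //= _; lia.
  split; last by move=> l /negPf->.
  rewrite [colk c == rowk c]eq_sym (negPf (rc c)) eqxx.
  by case: o o' ne => [[]|] [[]|] //= _; lia.
have inter i' o' : ~~ st c -> (i', o') = (i, o) /\ (i, o) = (false, None) \/
     (i', o') = (true, None) /\ (i, o) = (false, Some false) ->
   (posn (c, (i, o)) (dir c) != posn (prev c, (i', o')) (dir c) %[mod 6])%N /\
   forall l, l != dir c -> posn (prev c, (i', o')) l = posn (c, (i, o)) l.
  move=> sc io; have [c0 _ _ _] := st_step (cN c) sc.
  have /andP[ad /forallP al] : adj c (dir c) by apply: dirP; rewrite c0 cN.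
  have loc l : (posn (c, (i, o)) l + 3 * gr (prev c) l = posn (prev c, (i', o')) l + 3 * gr c l)%N.
    have oc : odd c = ~~ odd (prev c) by rewrite prevE -{1}(prednK c0).
    have : rowk c = colk (prev c) /\ colk c = rowk (prev c).
      by rewrite /rowk /colk oc; case: odd.
    case=> erow ecol; rewrite /posn /= erow ecol.
    have := rc (prev c); case: io => -[[-> ->] [-> ->]] ne /=; first by rewrite !if_same; lia.
    case: (l =P colk _) => [->|_]; first by rewrite [colk _ == _]eq_sym (negPf ne); lia.
    by case: ifP => _; lia.
  split.
    have := loc (dir c); rewrite prevE; move: ad; lia.
  move=> l /(implyP (al l)) /eqP el; have := loc l; rewrite prevE el; lia.
move=> bs e.
have [rE|rE] : t.1 = c /\ ((j == rowk c) && (o == t.2.2) && (i != t.2.1) ||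
     (j == colk c) && (i == t.2.1) && (o != t.2.2)) \/
   t.1 = prev c /\ j = dir c /\ ~~ st c /\ ((t.2.1, t.2.2) = (i, o) /\ (i, o) = (false, None) \/
     (t.2.1, t.2.2) = (true, None) /\ (i, o) = (false, Some false)).
  clear intra inter; move: bs e; rewrite /base /rel /=.
  case: i o => -[[]|] /=; do ?[case: ifP => ?]; rewrite ?andbT ?eqxx //= => ? [<-] /=;
     by [left; rewrite ?eqxx ?orbT ?andbT
        | right; do !split=> //; [exact/eqP|exact/negbT|auto]
        | right; do !split=> //; [exact/eqP|auto]].
- by case: t rE {e} => c' [i' o'] /= [-> rE]; apply: intra.
- by case: t rE {e} => c' [i' o'] /= [-> [-> [sc io]]]; apply: inter.
Qed.
(* Sites on a common axis-parallel line differ in their coordinate sum, and sites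
   related by a move differ modulo 6 in the moved coordinate; this keeps the
   auxiliary lines of different sites disjoint with only O(q) levels. *)
Let res (s : S) : {ffun 'I_d -> 'I_6} := [ffun k => inord (posn s k %% 6)].
Let W : nat := (6 ^ d * (3 * d * q))%N.
Let uval (s : S) : nat := (enum_rank (res s) * (3 * d * q) + \sum_k posn s k)%N.

Let sum_posn s : (\sum_k posn s k < 3 * d * q)%N.
Proof.
have d0 : (0 < d)%N by apply: ltnW.
apply: (@leq_ltn_trans (\sum_(k < d) (3 * q).-1)).
  by apply: leq_sum => k _; rewrite -ltnS prednK ?posn_lt // muln_gt0.
rewrite sum_nat_const card_ord mulnAC mulnC ltn_pmul2r // prednK // muln_gt0 //.
Qed.

Let uval_lt s : (uval s < W)%N.
Proof.
have lt : (enum_rank (res s) < 6 ^ d)%N.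
  by apply: leq_trans (ltn_ord _) _; rewrite card_ffun !card_ord.
apply: (@leq_trans ((enum_rank (res s)).+1 * (3 * d * q))); last by rewrite leq_mul2r lt orbT.
by rewrite mulSn /uval [ltnRHS]addnC ltn_add2l.
Qed.

Let posW s k : (posn s k < W)%N.
Proof.
apply: leq_trans (posn_lt s k) _; rewrite /W mulnA leq_mul2r; apply/orP; right.
have d0 : (0 < d)%N by apply: ltnW.
by move: (6 ^ d)%N (expn_gt0 6 d) => B /= B0; nia.
Qed.

Let uval_inj s t : uval s = uval t ->
  (forall k, posn s k = posn t k %[mod 6]) /\ \sum_k posn s k = \sum_k posn t k.
Proof.
move=> e; have lt s' := sum_posn s'.
have B0 : (0 < 3 * d * q)%N by apply: leq_ltn_trans (lt s).
have er : res s = res t.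
  apply/enum_rank_inj/val_inj.
  by have := congr1 (fun x => x %/ (3 * d * q))%N e; rewrite !divnMDl // !divn_small ?addn0.
split; last by move: e; rewrite /uval er => /addnI.
move=> k; have := congr1 (fun f : {ffun 'I_d -> 'I_6} => f k : nat) er.
by rewrite !ffunE !inordK ?ltn_pmod.
Qed.

Let pick1 (V : zmodType) (x : S -> V) (a : 'I_d) o :
  \sum_k oapp x 0 (if k == a then o else None) = oapp x 0 o.
Proof.
by rewrite (bigD1 a) //= eqxx big1 ?addr0 // => k /negPf->.
Qed.

Let pick2 (V : zmodType) (x : S -> V) (a b : 'I_d) o o' : a != b ->
  \sum_k oapp x 0 (if k == a then o else if k == b then o' else None)
  = oapp x 0 o + oapp x 0 o'.
Proof.
move=> ab; rewrite (bigD1 a) //= eqxx; congr (_ + _).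
rewrite (bigD1 b) /=; last by rewrite eq_sym.
rewrite eqxx eq_sym (negPf ab) big1 ?addr0 // => k /andP[/negPf-> /negPf->] //.
Qed.

Let sum_rel (V : zmodType) (x : S -> V) s : \sum_k oapp x 0 (rel s k) =
  let: (c, (i, j)) := s in
  match i, j with
  | false, None => x (E (prev c))
  | false, Some false => if st c then x (E c) else x (Wt (prev c))
  | false, Some true => x (P c)
  | true, Some false => x (P c)
  | true, Some true => x (C2 c) + x (C1 c)
  | true, None => x (D c) + (if bit c then x (E c) else 0)
  end.
Proof.
have rc c : colk c != rowk c by rewrite eq_sym.
case: s => c [[] [[]|]] /=; rewrite ?pick2 ?pick1 //=; first by case: (bit c).
by case: (st c); rewrite pick1.
Qed.

Let psi_base s : base s -> psi s = \sum_k oapp psi 0 (rel s k).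
Proof.
rewrite sum_rel; case: s => c [[] [[]|]]; rewrite /base /psi //=.
- by rewrite -mulrnDr addnn.
- by rewrite mulrnDr; case: (bit c); rewrite ?mulr0n.
- case: ifPn => [sc _|/(st_step (cN c))[_ cc -> _] _]; last by rewrite prevE cc.
  by have [_ ->] := st_start (cN c) sc.
- by rewrite andbT => /(st_step (cN c))[_ cc _ _]; rewrite prevE cc.
Qed.

Let psi_dead s : ~~ live s -> psi s = 0.
Proof.
rewrite /live negbK => /andP[ec]; case: s ec => c [i j] /= ec /eqP[-> ->].
by rewrite /psi /= (enP (cN c) ec) g_order.
Qed.

Let start_ord i : 'I_N.+1 := inord (start i).
Let start_ordE i : start_ord i = start i :> nat.
Proof. by have [sN _ _] := startP i; rewrite inordK. Qed.

(** Induction along the cells shows that, modulo [K], each site is its weight times the generator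
    [e] of its summand; the dead end site puts [m e] in [K]. A combination that vanishes in [G] has
    total coefficients divisible by the orders. *)
Let psi_pres (V : zmodType) (K : V -> Prop) (x : S -> V) :
  subgroup K -> (forall s, ~~ live s -> x s = 0) ->
  (forall s, base s -> K (x s - \sum_j oapp x 0 (rel s j))) ->
  forall (J : finType) (f : J -> S) (c : J -> int),
    \sum_j psi (f j) *~ c j = 0 -> K (\sum_j x (f j) *~ c j).
Proof.
move=> sK x_dead Kbase.
pose e i := x (E (start_ord i)).
have KB a b c : K (a - b) -> K (b - c) -> K (a - c).
  by move=> Kab Kbc; have := subgroupD sK Kab Kbc; rewrite addrA subrK.
have KD a b a' b' : K (a - a') -> K (b - b') -> K (a + b - (a' + b')).
  by move=> Ka Kb; have := subgroupD sK Ka Kb; rewrite addrACA -opprD.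
have Krel s : base s -> K (x s - let: (c, (i, j)) := s in
  match i, j with
  | false, None => x (E (prev c))
  | false, Some false => if st c then x (E c) else x (Wt (prev c))
  | false, Some true => x (P c)
  | true, Some false => x (P c)
  | true, Some true => x (C2 c) + x (C1 c)
  | true, None => x (D c) + (if bit c then x (E c) else 0)
  end) by rewrite -sum_rel; exact: Kbase.
pose Q c := forall i j, K (x (c, (i, j)) - e (comp c) *+ weight (c, (i, j))).
have Q_step (c : 'I_N.+1) : ((0 < c)%N -> Q (prev c)) -> Q c.
  move=> Qp.
  have KE : K (x (E c) - e (comp c)).
    have [sc|nsc] := boolP (st c).
      rewrite /e (_ : start_ord _ = c) ?subrr; first exact: sK.1.
      by apply: val_inj; rewrite /= start_ordE; have [<-] := st_start (cN c) sc.
    have bE : base (E c) by rewrite /base /= andbT.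
    have [c0 cc _ _] := st_step (cN c) nsc.
    by apply: KB (Krel _ bE) _; have := Qp c0 false None; rewrite /= prevE -cc.
  have KP : K (x (P c) - e (comp c) *+ w c).
    apply: KB (Krel (P c) _) _; first by rewrite /base andbF.
    case: ifPn => sc /=; first by have [_ ->] := st_start (cN c) sc.
    have [c0 cc -> _] := st_step (cN c) sc.
    by have := Qp c0 true None; rewrite /= prevE -cc.
  have KC1 : K (x (C1 c) - e (comp c) *+ w c).
    by apply: KB (Krel (C1 c) _) KP; rewrite /base andbF.
  have KC2 : K (x (C2 c) - e (comp c) *+ w c).
    by apply: KB (Krel (C2 c) _) KP; rewrite /base andbF.
  have KDD : K (x (D c) - e (comp c) *+ (w c).*2).
    apply: KB (Krel (D c) _) _; first by rewrite /base andbF.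
    by rewrite -addnn mulrnDr; apply: KD.
  case=> -[[]|] //=; apply: KB (Krel (Wt c) _) _; first by rewrite /base andbF.
  rewrite mulrnDr; apply: KD => //; case: (bit c) => //.
  by rewrite subrr; exact: sK.1.
have Qall (c : 'I_N.+1) : Q c.
  have [n cn] : exists n, c = n :> nat by exists c.
  elim: n c cn => [|n IH] c cn; apply: Q_step; rewrite cn // => _.
  by apply: IH; rewrite prevE cn.
have Ke i : K (e i *+ m i).
  have [c [cN' ec ci]] := en_ex i; have co : (inord c : 'I_N.+1) = c :> nat by rewrite inordK.
  have := Qall (inord c) true None; rewrite x_dead /=; last first.
    by rewrite /live /= co ec.
  by rewrite co enP // ci sub0r => /(subgroupN sK); rewrite opprK.
move=> J f c c0.
pose a i := \sum_(j | comp (f j).1 == i) (weight (f j))%:Z * c j.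
have aE (V' : zmodType) (h : 'I_r -> V') :
    \sum_i h i *~ a i = \sum_j h (comp (f j).1) *+ weight (f j) *~ c j.
  rewrite [RHS](partition_big (fun j => comp (f j).1) xpredT) //=.
  apply: eq_bigr => i _; rewrite mulrz_sumr; apply: eq_bigr => j /eqP->.
  by rewrite mulrzA.
have -> : \sum_j x (f j) *~ c j =
    \sum_j (x (f j) - e (comp (f j).1) *+ weight (f j)) *~ c j + \sum_i e i *~ a i.
  by rewrite aE -big_split; apply: eq_bigr => j _ /=; rewrite -mulrzDl subrK.
apply: subgroupD => //; apply: subgroup_sum => // j _.
  by apply: subgroupMz => //; case: (f j) => b [i o]; apply: Qall.
have [b ->] : exists b, a j = (m j)%:Z * b by apply: g_free; rewrite aE.
by rewrite mulrzA; apply: subgroupMz => //; apply: Ke.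
Qed.

Lemma program_realizable : realizable d G (d.+1 * (6 ^ d * (3 * d * q))).+1.
Proof.
apply: (@grid_realizable d W G S (ltnW d_gt1) (fun s k => Ordinal (posW s k))
  (fun s => Ordinal (uval_lt s)) base live rel psi).
- by move=> s t e; apply: posn_inj => k; have [] := e k.
- by move=> s j t bs e k kj; apply: val_inj; have [_ /(_ k kj)] := rel_geom bs e.
(* Equal levels give equal coordinate sums, so the one remaining coordinate agrees too. *)
- move=> s t k [/uval_inj[_ es]] e; apply: posn_inj => l.
  have el k' : k' != k -> posn s k' = posn t k' by move=> /e[].
  have [->|/el//] := eqVneq l k.
  move: es; rewrite (bigD1 k) //= [RHS](bigD1 k) //= (eq_bigr _ el).
  exact: addIn.
(* Equal levels make [s'] and [s] congruent modulo 6 in coordinate [j], where [s'] agrees with [t];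
   the move forbids this. *)
- move=> s t j s' k bs rst kj [/uval_inj[er _]] e.
  have jk : j != k by rewrite eq_sym.
  by have [] := e j jk => ej; have [/negP[]] := rel_geom bs rst; rewrite -er ej.
- move=> [c [i o]] j t _; rewrite /live => e.
  (* The only move onto a site [Wt] goes back to the previous cell, which is no end cell because the
     current one is no start. *)
  suff : en t.1 -> t.2 != (true, None) by case: (en _) => //= ->.
  case: i o e => -[[]|] /=; do ?[case: ifPn => ? //]; case=> <- //=.
  by have [_ _ _ /negPf] := st_step (cN c) ltac:(eassumption); rewrite prevE => ->.
- exact: psi_dead.
- exact: psi_base.
- exact: psi_pres.
- move=> h; have [a ah] := g_gen h.
  exists (fun s => \sum_(i | s == E (start_ord i)) a i).
  under eq_bigr do rewrite mulrz_sumr.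
  rewrite (exchange_big_dep xpredT) //= -ah; apply: eq_bigr => i _.
  rewrite (big_pred1 (E (start_ord i))) // /psi /= start_ordE mulr1n.
  by have [_ _ ->] := startP i.
Qed.
End Program.

(** * Cyclic decomposition of a finite abelian group *)

Lemma finZmod_basis (G : finZmodType) : exists r (m : 'I_r -> nat) (g : 'I_r -> G),
  [/\ forall i, (1 < m i)%N /\ g i *+ m i = 0,
      (\prod_i m i = #|G|)%N,
      forall h, exists a : 'I_r -> int, \sum_i g i *~ a i = h &
      forall a : 'I_r -> int, \sum_i g i *~ a i = 0 ->
        forall i, exists b, a i = (m i)%:Z * b].
Proof.
have abG : abelian [set: G] by apply/centsP=> x _ y _; exact: addrC.
have [b defG ob] := @abelian_structure _ [set: G]%G abG.
rewrite big_tnth in defG; set g := tnth (in_tuple b) in defG.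
have sumE (c : 'I_(size b) -> G) : (\prod_i c i)%g = \sum_i c i by [].
exists (size b), (fun i => #[g i]%g), g; split.
- move=> i; split; last by rewrite -FinRing.zmodXgE expg_order.
  have /allP := @abelian_type_gt1 _ [set: G]; apply; rewrite -ob.
  by apply: map_f; apply: mem_tnth.
- by rewrite -cardsT (bigdprod_card defG).
- move=> h; have [c [cg hc _]] := mem_bigdprod defG (in_setT h).
  have /fin_all_exists[a ac] i : exists a : int, g i *~ a = c i.
    by have /cycleP[k ->] := cg i isT; exists k%:Z; rewrite FinRing.zmodXgE.
  by exists a; rewrite hc sumE; apply: eq_bigr.
move=> a a0 i; have [c [_ _ cu]] := mem_bigdprod defG (in_setT 0).
(* Uniqueness of the decomposition of 0 makes each component vanish. *)
have ga : g i *~ a i = 0.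
  rewrite (cu (fun i => g i *~ a i)) //.
    by rewrite -(cu (fun=> 0)) // => [k _|]; [exact: group1|rewrite sumE big1].
  move=> k _; case: (a k) => n; first by apply/cycleP; exists n; rewrite FinRing.zmodXgE.
  by rewrite NegzE mulrNz; apply: groupVr; apply/cycleP; exists n.+1; rewrite FinRing.zmodXgE.
have : (#[g i]%g %| `|a i|)%N.
  rewrite order_dvdn FinRing.zmodXgE; apply/eqP.
  case: (a i) ga => n //; rewrite NegzE mulrNz => /eqP.
  by rewrite oppr_eq0 => /eqP.
rewrite -/(dvdz #[g i]%g (a i)) => /dvdzP[k ->]; exists k; exact: mulrC.
Qed.

(** * Binary digits of the orders, laid out as a sequence of cells *)

Section Horner.
Variables (r : nat) (m : 'I_r -> nat).
Hypothesis m_gt1 : forall i, (1 < m i)%N.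

Let K (i : 'I_r) := trunc_log 2 (m i).
(* The cell [(i, k)] takes [m i %/ 2 ^ k] to [m i %/ 2 ^ k.-1]. *)
Definition cells : seq ('I_r * nat) :=
  [seq (i, (K i - c)%N) | i <- enum 'I_r, c <- iota 0 (K i)].

Lemma size_cells : size cells = (\sum_i K i)%N.
Proof.
rewrite size_allpairs_dep sumnE big_map big_enum /=.
by apply: eq_bigr => i _; rewrite size_iota.
Qed.

Lemma trunc_log2_gt0 i : (0 < K i)%N.
Proof. by have := trunc_log_max (leqnn 2) (m_gt1 i : 2 ^ 1 <= _)%N. Qed.

Lemma mem_cells i k : ((i, k) \in cells) = (0 < k <= K i)%N.
Proof.
apply/allpairsPdep/idP => [[j [c [_ + [-> ->]]]]|/andP[k0 kK]].
  by rewrite mem_iota; lia.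
by exists i, (K i - k)%N; rewrite mem_enum mem_iota subKn //; split=> //; lia.
Qed.

Lemma cells_uniq : uniq cells.
Proof.
apply: allpairs_uniq_dep => [|i _|]; rewrite ?enum_uniq ?iota_uniq //.
move=> _ _ /allpairsPdep[i [c [_ ci ->]]] /allpairsPdep[j [e [_ ej ->]]] /= [eij].
move: ci ej; rewrite !mem_iota eij => ci ej ece.
by rewrite (_ : c = e) //; lia.
Qed.

Lemma cells_step x0 c : (c < size cells)%N ->
  let: (i, k) := nth x0 cells c in
  k = K i \/ (0 < c)%N /\ nth x0 cells c.-1 = (i, k.+1).
Proof.
rewrite /cells; elim: (enum 'I_r) c => [|i s IH] c //=.
rewrite size_cat size_map size_iota !nth_cat size_map size_iota.
have [lt _|ge lt] := ltnP c (K i).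
  rewrite (nth_map 0) ?size_iota // nth_iota // add0n.
  case: c lt => [|c] lt; first by left; rewrite subn0.
  right; split=> //; rewrite /= (ltnW lt) (nth_map 0) ?size_iota ?(ltnW lt) //.
  by rewrite nth_iota ?(ltnW lt) // add0n; congr (_, _); lia.
have := IH (c - K i)%N; case: nth => j k; case; first by rewrite ltn_subLR.
  by left.
case=> c0 e; right; split; first lia.
by rewrite ifF; [rewrite -e; congr nth; lia | lia].
Qed.
End Horner.

(** [N] counts the cells, the sum of the integer parts of log2 of the orders [m i]; since
    [2 ^ K i <= m i], it is at most log2 of the order of [G]. *)
Lemma group_realizable d (G : finZmodType) : (1 < d)%N -> (1 < #|G|)%N ->
  exists N, [/\ (0 < N)%N, (2 ^ N <= #|G|)%N & forall q, (N <= q ^ d)%N ->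
    realizable d G (d.+1 * (6 ^ d * (3 * d * q))).+1].
Proof.
move=> d1 G1; have [r [m [g [mP cardG g_gen g_free]]]] := finZmod_basis G.
have m1 i : (1 < m i)%N by have [] := mP i.
case: r => [|r] in m g mP cardG g_gen g_free m1 *.
  by rewrite big_ord0 in cardG; rewrite -cardG in G1.
pose K i := trunc_log 2 (m i).
have K0 i : (0 < K i)%N := trunc_log2_gt0 m1 i.
have sz0 : (0 < size (cells m))%N.
  by rewrite size_cells (bigD1 ord0) //=; apply: ltn_addr; apply: K0.
exists (size (cells m)); split=> // [|q].
  rewrite size_cells expn_sum -cardG; apply: leq_prod => i _.
  by have /andP[] := trunc_log_bounds (leqnn 2) (ltnW (m1 i)).
case eN: (size _) sz0 => [//|N] _ Nq.
have q0 : (0 < q)%N by case: q Nq => // ; rewrite exp0n // ltnW.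
pose x0 : 'I_r.+1 * nat := (ord0, 0%N).
pose cell c := nth x0 (cells m) c.
have mem_cell c : (c <= N)%N -> cell c \in cells m by move=> cN; rewrite mem_nth ?eN.
have idx i k : (0 < k <= K i)%N ->
    (index (i, k) (cells m) <= N)%N /\ cell (index (i, k) (cells m)) = (i, k).
  by rewrite -mem_cells => ik; rewrite -ltnS -eN index_mem /cell nth_index.
(* Cell [(i, k)] holds [m i %/ 2 ^ k] and appends the next binary digit. A summand starts at
   [k = K i] with weight 1 and ends at [k = 1] with output [m i]. *)
apply: (@program_realizable d q N r.+1 G d1 q0 Nq g m
  (fun i => index (i, K i) (cells m)) (fun c => (cell c).1)
  (fun c => m (cell c).1 %/ 2 ^ (cell c).2)%N
  (fun c => odd (m (cell c).1 %/ 2 ^ (cell c).2.-1))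
  (fun c => (cell c).2 == K (cell c).1) (fun c => (cell c).2 == 1%N)) => //.
- by move=> i; have [] := mP i.
- by move=> i; have [|iN ->] := idx i (K i); rewrite ?K0 //= eqxx.
- move=> c cN /eqP ec; rewrite -ec -surjective_pairing index_uniq ?cells_uniq ?eN //.
  split=> //; rewrite ec; have /andP[lo hi] := trunc_log_bounds (leqnn 2) (ltnW (m1 (cell c).1)).
  have e0 : (0 < 2 ^ K (cell c).1)%N by rewrite expn_gt0.
  apply/eqP; rewrite eqn_leq -ltnS ltn_divLR // -expnS hi /=.
  by rewrite divn_gt0.
- move=> c cN ncK; have := @cells_step _ m x0 c; rewrite eN -/(cell c) -/(cell c.-1).
  have := mem_cell _ cN; case ec: (cell c) ncK => [i k] /= ncK.
  rewrite mem_cells => /andP[k0 _] /(_ cN) [ek|[c0 ->]] /=; first by rewrite ek eqxx in ncK.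
  split=> //; last by rewrite eqSS -lt0n.
  by rewrite expnSr divnMA divn2 addnC odd_double_half.
- move=> c cN /eqP ->; rewrite expn1 expn0 divn1 divn2 addnC.
  exact: odd_double_half.
- move=> i; have [|iN e] := idx i 1%N; first by rewrite /= K0.
  by exists (index (i, 1%N) (cells m)); rewrite e.
Qed.

(** * Lower bound *)

(** Laplace expansion along the first row: deleting entries does not increase the l1-norms, so the
    minors satisfy the same bound. *)
Lemma normr_det_le (R : numDomainType) r (M : 'M[R]_r) (k : R) :
  (forall i, \sum_j `|M i j| <= k) -> `|\det M| <= k ^+ r.
Proof.
elim: r M => [|r IH] M Mk; first by rewrite det_mx00 normr1 expr0.
have k0 : 0 <= k by apply: le_trans (Mk ord0); apply: sumr_ge0.
rewrite (expand_det_row M ord0) exprS (le_trans (ler_norm_sum _ _ _)) //.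
apply: le_trans (ler_wpM2r _ (Mk ord0)); last exact: exprn_ge0.
rewrite mulr_suml; apply: ler_sum => j _; rewrite normrM ler_wpM2l //.
rewrite /cofactor normrM normrX normrN1 expr1n mul1r; apply: IH => i.
apply: le_trans (Mk (lift ord0 i)); rewrite [leRHS](bigD1_ord j) //=.
by under eq_bigr do rewrite !mxE; rewrite lerDr.
Qed.

(* The rows of [M] span a lattice of index [|\det M|], by the Smith normal form. *)
Lemma index_le_det (T : finType) r (M : 'M[int]_r) (x : T -> 'rV[int]_r) :
  \det M != 0 -> (forall g h y, x g - x h = y *m M -> g = h) ->
  (#|T| <= `|\det M|)%N.
Proof.
have [L uL [R uR [s _ ->]]] := int_Smith_normal_form M.
set D := \matrix_(i, j) _ => dM xM.
have dD : \det D = \prod_(i < r) s`_i.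
  rewrite (_ : D = diag_mx (\row_i s`_i)) ?det_diag; last first.
    by apply/matrixP=> i j; rewrite !mxE.
  by apply: eq_bigr => i _; rewrite mxE.
have s0 (i : 'I_r) : s`_i != 0.
  by move: dM; rewrite !det_mulmx !mulf_eq0 !negb_or dD prodf_seq_neq0 => /andP[/andP[_ /allP]] h _;
     apply: (implyP (h i _)); rewrite ?mem_index_enum.
have abs1 (A : 'M[int]_r) : A \in unitmx -> `|\det A|%N = 1%N.
  by rewrite unitmxE => /orP[] /eqP->.
pose a_ (i : 'I_r) := s`_i.
have -> : `|\det (L *m D *m R)|%N = (\prod_(i < r) `|a_ i|)%N.
  rewrite !det_mulmx !abszM (abs1 L) // (abs1 R) // mul1n muln1 dD.
  by elim/big_rec2: _ => // i a b _ <-; rewrite abszM.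
have lt g (i : 'I_r) : (`|((x g *m invmx R) 0%R i %% a_ i)%Z| < `|a_ i|)%N.
  by rewrite -ltz_nat abszE ger0_norm ?modz_ge0 ?s0 // ltz_mod ?s0.
(* After the unimodular change of coordinates, record the residues of [x g] modulo the diagonal
   entries; equal residues mean a difference in the row lattice. *)
pose F g : {dffun forall i : 'I_r, 'I_(`|a_ i|)} := [ffun i => Ordinal (lt g i)].
have -> : (\prod_(i < r) `|a_ i|)%N = #|{dffun forall i : 'I_r, 'I_(`|a_ i|)}|.
  rewrite card_dep_ffun foldrE big_map big_enum /=.
  by apply: eq_bigr => i _; rewrite card_ord.
rewrite -[X in (_ <= X)%N]cardsT -(card_imset _ (_ : injective F)) ?subset_leq_card ?subsetT //.
move=> g h Fgh; pose v i := ((x g - x h) *m invmx R) 0 i.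
pose e : 'rV[int]_r := \row_i (v i %/ a_ i)%Z.
have dv i : (a_ i %| v i)%Z.
  have -> : v i = (x g *m invmx R) 0 i - (x h *m invmx R) 0 i.
    by rewrite /v mulmxBl !mxE.
  rewrite -eqz_mod_dvd; apply/eqP.
  have := congr1 (fun f : {dffun forall i : 'I_r, 'I_(`|a_ i|)} => f i : nat) Fgh.
  by rewrite !ffunE /= => /(congr1 Posz); rewrite !abszE !ger0_norm ?modz_ge0 ?s0.
apply: (xM g h (e *m invmx L)); rewrite -!mulmxA mulKmx // mulmxA.
suff <- : (x g - x h) *m invmx R = e *m D by rewrite mulmxKV.
apply/rowP=> i; rewrite [RHS]mxE (bigD1 i) //= big1 ?addr0 => [|j ji]; last first.
  by rewrite !mxE val_eqE (negPf ji) mulr0n mulr0.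
by rewrite [e 0 i]mxE [D i i]mxE eqxx mulr1n divzK.
Qed.

Lemma bin_le_exp n k : ('C(n, k) <= n ^ k)%N.
Proof.
apply: (@leq_trans ('C(n, k) * k`!)); first by rewrite leq_pmulr ?fact_gt0.
rewrite bin_ffact; elim: k => [|k IH]; first by rewrite ffactn0 expn0.
by rewrite ffactnSr expnSr leq_mul // leq_subr.
Qed.

(** Each vertex of [t] accounts for one face, with coefficient 1 or -1. *)
Lemma sum_bd_delta n (t : {set 'I_n}) :
  \sum_s `|bd (delta_chain t) s| <= #|t|%:R.
Proof.
have le1 : \sum_s `|bd (delta_chain t) s| <=
    \sum_(s : {set 'I_n}) \sum_(v | v \notin s) ((v |: s == t)%:R : int).
  apply: ler_sum => s _; rewrite bdE (le_trans (ler_norm_sum _ _ _)) //.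
  apply: ler_sum => v _; rewrite ffunE normrM /sgb normrX normrN1 expr1n mul1r.
  by rewrite normr_nat.
apply: le_trans le1 _; rewrite (exchange_big_dep xpredT) //=.
rewrite [leRHS](_ : _ = \sum_(v in t) 1); last by rewrite sumr_const.
rewrite [leRHS]big_mkcond /=; apply: ler_sum => v _.
rewrite big_mkcond (bigD1 (t :\ v)) //= big1 ?addr0 => [|s st].
  rewrite !inE eqxx /=; case: ifP => vt; first by rewrite setD1K ?eqxx.
  by case: eqP => // e; rewrite -e setU11 in vt.
case: ifP => // vs; case: eqP => // e.
by rewrite -e setU1K ?vs ?eqxx in st.
Qed.

Lemma realizable_card_le d n (G : finZmodType) :
  (0 < d)%N -> realizable d G n -> (#|G| <= d.+1 ^ (n ^ d))%N.
Proof.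
move=> d0 [X [_ [f [fT fD f0 _]]]]; rewrite /torsion_cycle /kboundary prednK // in fT fD f0.
have kcB b c : kchain X d b -> kchain X d c -> kchain X d (b - c).
  move=> bX cX s; rewrite !ffunE; have [->|/bX//] := eqVneq (b s) 0.
  by rewrite sub0r oppr_eq0 => /cX.
have f_inj g h b : kchain X d b -> f g - f h = bd b -> g = h.
  move=> bX e; apply/eqP; rewrite -subr_eq0; apply/eqP/f0.
  have [b' [b'X]] := fD (g - h) h; rewrite subrK addrAC e => e'.
  exists (b - b'); split; first exact: kcB.
  by rewrite raddfB /= -e' subKr.
pose T := {set 'I_n}; pose ok (t : T) := (t \in X) && (#|t| == d.+1).
(* The boundary matrix in dimension d, indexed by all vertex sets, with zero rows for sets that are
   not d-simplices of [X]. *)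
pose A : 'M[int]_#|T| :=
  \matrix_(i, j) if ok (enum_val i) then bd (delta_chain (enum_val i)) (enum_val j) else 0.
pose toQ k l (M : 'M[int]_(k, l)) : 'M[rat]_(k, l) := map_mx intr M.
pose vec (z : chain n) : 'rV[int]_#|T| := \row_j z (enum_val j).
(* Select a maximal set of rationally independent rows, then as many independent columns: [M] is a
   nonzero minor of maximal size. *)
pose B := rowsub (maxrankfun (toQ _ _ A)) (toQ _ _ A).
have B_free : row_free B by apply: maxrowsub_free.
have BT_full : row_full B^T by rewrite /row_full mxrank_tr; exact: B_free.
set r := \rank _ in B B_free BT_full.
set rho := maxrankfun _ in B B_free BT_full.
pose gam := fullrankfun BT_full.
pose M : 'M[int]_r := \matrix_(a, b) A (rho a) (gam b).
have MQ : toQ _ _ M = (rowsub gam B^T)^T by apply/matrixP=> a b; rewrite !mxE.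
have uM : toQ _ _ M \in unitmx by rewrite MQ unitmx_tr fullrowsub_unit.
have dM : \det M != 0.
  by move: uM; rewrite unitmxE unitfE det_map_mx intr_eq0.
have vec_bd b : kchain X d b -> vec (bd b) = vec b *m A.
  move=> bX; apply/rowP=> j; rewrite !mxE bd_delta_sum.
  rewrite (reindex (@enum_val T xpredT)); last exact/onW_bij/enum_val_bij.
  apply: eq_bigr => i _; rewrite !mxE; case: ifPn => // nok.
  have [->|/bX[tX ct]] := eqVneq (b (enum_val i)) 0; first by rewrite !mul0r.
  by rewrite /ok tX ct eqxx in nok.
(* A multiple of a torsion cycle bounds, so the cycle lies in the rational row space. *)
have span_f g : (toQ _ _ (vec (f g)) <= toQ _ _ A)%MS.
  have [_ [k [k0 [b [bX e]]]]] := fT g.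
  have k0' : (k%:R : rat) != 0 by rewrite pnatr_eq0 -lt0n.
  rewrite -(eqmx_scale _ k0') (_ : _ *: _ = toQ _ _ (vec b) *m toQ _ _ A) ?submxMl //.
  rewrite -map_mxM -vec_bd // -e; apply/rowP=> j; rewrite !mxE.
  by rewrite ffunMnE rmorphMn /= mulr_natl.
(* A vector of the row space is determined by the selected columns, since [M] is invertible over the
   rationals. *)
have zero_of (u : 'rV[rat]_#|T|) : (u <= toQ _ _ A)%MS ->
    (forall b, u 0 (gam b) = 0) -> u = 0.
  rewrite -(eq_maxrowsub (toQ _ _ A)) -/rho -/B => /submxP[y ->] uy.
  suff -> : y = 0 by rewrite mul0mx.
  apply: (can_inj (mulmxK uM)); rewrite mul0mx; apply/rowP=> b.
  by rewrite MQ [RHS]mxE -(uy b) !mxE; apply: eq_bigr => a _; rewrite !mxE.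
pose x g : 'rV[int]_r := \row_b f g (enum_val (gam b)).
(* The integer combination [y] of the full rows is a boundary that agrees with [f g - f h] on the
   selected columns, hence everywhere. *)
have x_inj g h y : x g - x h = y *m M -> g = h.
  move=> e; pose tau a : T := enum_val (rho a).
  pose c : chain n := \sum_a (if ok (tau a) then delta_chain (tau a) *~ y 0 a else 0).
  have cX : kchain X d c.
    move=> s; have [/andP[sX /eqP cs] //|ns] := boolP (ok s).
    rewrite sum_ffunE big1 ?eqxx // => a _; case: ifPn => [oka|_]; last by rewrite ffunE.
    rewrite ffunMzE ffunE; case: eqP => [es|]; last by rewrite mul0rz.
    by rewrite es oka in ns.
  apply: (f_inj _ _ c cX).
  have bdc s : bd c s = \sum_a y 0 a * A (rho a) (enum_rank s).
    rewrite raddf_sum sum_ffunE; apply: eq_bigr => a _; rewrite mxE enum_rankK -/(tau a).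
    case: ifP => _; last by rewrite raddf0 ffunE mulr0.
    by rewrite raddfMz ffunMzE mulrzz mulrC.
  pose u := toQ _ _ (vec (f g - f h - bd c)).
  have u0 : u = 0.
    apply: zero_of => [|b].
      rewrite /u (_ : toQ _ _ _ = toQ _ _ (vec (f g)) - toQ _ _ (vec (f h)) - toQ _ _ (vec (bd c))).
        apply: addmx_sub; last by rewrite eqmx_opp vec_bd // /toQ map_mxM submxMl.
        by apply: addmx_sub; rewrite ?eqmx_opp; exact: span_f.
      by apply/rowP=> j; rewrite !mxE !ffunE !rmorphB.
    have := congr1 (fun u : 'rV[int]_r => u 0 b) e; rewrite !mxE => eb.
    have -> : (f g - f h - bd c) (enum_val (gam b)) =
        f g (enum_val (gam b)) - f h (enum_val (gam b)) - bd c (enum_val (gam b)).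
      by rewrite !ffunE.
    rewrite eb bdc enum_valK -sumrB big1 // => a _.
    by rewrite mxE subrr.
  apply/eqP; rewrite -subr_eq0; apply/eqP/ffunP=> s.
  have := congr1 (fun u : 'rV[rat]_#|T| => u 0 (enum_rank s)) u0.
  by rewrite !mxE enum_rankK => /eqP; rewrite intr_eq0 => /eqP->; rewrite ffunE.
have row_le a : \sum_b `|M a b| <= d.+1%:R.
  under eq_bigr do rewrite mxE.
  rewrite -(big_imset (fun j => `|A (rho a) j|)) /=; last first.
    by move=> b b' _ _; apply: fullrankfun_inj.
  apply: (@le_trans _ _ (\sum_j `|A (rho a) j|)).
    rewrite [leRHS](bigID (mem [set gam b | b in predT])) /= lerDl.
    exact: sumr_ge0.
  rewrite (reindex (@enum_rank T)) /=; last exact/onW_bij/enum_rank_bij.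
  have [oka|/negPf nok] := boolP (ok (enum_val (rho a))); last first.
    by rewrite big1 // => s _; rewrite mxE nok normr0.
  under eq_bigr do rewrite mxE oka enum_rankK.
  by have /andP[_ /eqP <-] := oka; exact: sum_bd_delta.
(* A nonsingular minor has no zero column, so every selected column is indexed by a set of d
   vertices. *)
have r_le : (r <= n ^ d)%N.
  rewrite -[r]card_ord -(card_imset _ (fullrankfun_inj (rkA := BT_full))) -/gam.
  apply: leq_trans (bin_le_exp n d).
  rewrite -[n in 'C(n, _)]card_ord -card_draws -(card_imset _ (@enum_val_inj T xpredT)).
  apply/subset_leq_card/subsetP=> _ /imsetP[_ /imsetP[b _ ->] ->]; rewrite inE.
  apply: contraNT dM => nd; rewrite (expand_det_col M b) big1 // => a _.
  rewrite [M a b]mxE mxE; case: ifP => [/andP[_ /eqP cs]|_]; last by rewrite mul0r.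
  rewrite (_ : bd _ _ = 0) ?mul0r //; apply: contraNeq nd => /bd_neq0[v vs].
  rewrite ffunE; case: (_ |: _ =P _) => [ev _|]; last by rewrite eqxx.
  by rewrite -eqSS -cs -ev cardsU1 vs.
apply: leq_trans (index_le_det dM x_inj) _.
have := normr_det_le row_le; rewrite -abszE -natrX natz lez_nat => /leq_trans-> //.
by rewrite leq_exp2l.
Qed.

(** * The upper bound in integer form *)

Lemma realizable_trivial d (G : finZmodType) : #|G| = 1%N -> realizable d G 0.
Proof.
move=> G1; have G0 (g : G) : g = 0.
  by have /fintype_le1P/(_ 0 g) : (#|G| <= 1)%N by rewrite G1.
have ch0 k (c : chain 0) : kchain set0 k c -> c = 0.
  move=> cX; apply/ffunP=> s; rewrite [RHS]ffunE; apply/eqP/negPn/negP => /cX[].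
  by rewrite inE.
exists set0; split; first by split=> [|s t]; rewrite inE.
have kc0 k : kchain (set0 : {set {set 'I_0}}) k 0 by move=> s; rewrite ffunE eqxx.
have kb0 : kboundary (set0 : {set {set 'I_0}}) d.-1 0 by exists 0; rewrite raddf0.
exists (fun=> 0); split=> // [g|g h|z [[/ch0-> _] _]].
- split; first by split; [exact: kc0|exact: raddf0].
  by exists 1%N; rewrite mul0rn.
- by rewrite !subr0.
- by exists 0; rewrite subr0.
Qed.

Lemma realizable_upper d : (1 < d)%N -> exists D, forall G : finZmodType,
  exists N n, [/\ realizable d G n, (2 ^ N <= #|G|)%N & (n ^ d <= D ^ d * N)%N].
Proof.
(* The factor 2 pays for rounding [q] up, the successor for the cone point. *)
move=> d1; set D := (d.+1 * (6 ^ d * (3 * d)))%N; exists (2 * D.+1)%N => G.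
(* For the trivial group the logarithm is 0, so only the empty complex on no vertices meets the
   bound. *)
have [G1|G_le1] := ltnP 1 #|G|; last first.
  have G1 : #|G| = 1%N by apply/eqP; rewrite eqn_leq G_le1; apply/card_gt0P; exists 0.
  exists 0%N, 0%N; rewrite G1 muln0 exp0n ?(ltnW d1) //; split=> //.
  exact: realizable_trivial.
have [N [N0 NG NX]] := group_realizable d1 G1.
have ex_q : exists q, (N <= q ^ d)%N.
  by exists N; rewrite -{1}[N]expn1 leq_pexp2l // ltnW.
have [q Nq q_min] := ex_minnP ex_q.
exists N, (d.+1 * (6 ^ d * (3 * d * q))).+1; split=> //; first exact: NX.
have q0 : (0 < q)%N by case: q Nq {q_min} => //; rewrite exp0n ?(ltnW d1) // leqNgt N0.
(* For [q] at least 2, minimality gives [(q - 1) ^ d <= N], and [q <= 2 (q - 1)]. *)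
have qN : (q ^ d <= 2 ^ d * N)%N.
  case: q q0 {Nq} q_min => // -[_ _|q _ q_min].
    by rewrite exp1n muln_gt0 expn_gt0.
  apply: (@leq_trans ((2 * q.+1) ^ d)); first by rewrite leq_exp2r ?(ltnW d1) //; lia.
  rewrite expnMn leq_mul2l; apply/orP; right; rewrite leqNgt; apply/negP => lt.
  by have := q_min q.+1 (ltnW lt); rewrite ltnn.
have -> : ((2 * D.+1) ^ d * N = D.+1 ^ d * (2 ^ d * N))%N.
  by rewrite [in LHS](mulnC 2%N) expnMn mulnA.
apply: (@leq_trans (D.+1 ^ d * q ^ d)); last by rewrite leq_mul2l qN orbT.
by rewrite -expnMn leq_exp2r ?(ltnW d1) // /D; nia.
Qed.

(* Real logarithms and d-th roots *)
From mathcomp Require Import all_classical all_reals all_analysis.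
From mathcomp Require Import Rstruct Rstruct_topology.

Section RealBounds.
Variable R : realType.

Lemma powR_exprnK (d : nat) (a : R) :
  (0 < d)%N -> 0 <= a -> (a ^+ d) `^ d%:R^-1 = a.
Proof.
move=> d0 a0; rewrite -powR_mulrn // -powRrM divff ?powRr1 //.
by rewrite pnatr_eq0 -lt0n.
Qed.

Lemma root_le (d : nat) (a b : R) : (0 < d)%N -> 0 <= a -> 0 <= b ->
  a ^+ d <= b -> a <= b `^ d%:R^-1.
Proof.
move=> d0 a0 b0 ab; rewrite -[leLHS](powR_exprnK d0 a0).
by rewrite ge0_ler_powR ?invr_ge0 ?ler0n // nnegrE // exprn_ge0.
Qed.

Lemma le_root (d : nat) (a b : R) : (0 < d)%N -> 0 <= a -> 0 <= b ->
  b <= a ^+ d -> b `^ d%:R^-1 <= a.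
Proof.
move=> d0 a0 b0 ab; rewrite -[leRHS](powR_exprnK d0 a0).
by rewrite ge0_ler_powR ?invr_ge0 ?ler0n // nnegrE // exprn_ge0.
Qed.

Lemma ln_nat_ge0 n : 0 <= ln (n%:R : R).
Proof.
case: n => [|n]; first by rewrite ln0.
by rewrite ln_ge0 // ler1n.
Qed.

Lemma le_ln_exp (a b k : nat) : (0 < a)%N -> (0 < b)%N -> (a <= b ^ k)%N ->
  ln (a%:R : R) <= k%:R * ln (b%:R : R).
Proof.
move=> a0 b0 ab; rewrite mulr_natl -lnXn ?ltr0n // -natrX.
by rewrite ler_ln ?posrE ?ltr0n ?expn_gt0 ?b0 // ler_nat.
Qed.

Lemma exp_le_ln (a b k : nat) : (0 < a)%N -> (0 < b)%N -> (b ^ k <= a)%N ->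
  k%:R * ln (b%:R : R) <= ln (a%:R : R).
Proof.
move=> a0 b0 ab; rewrite mulr_natl -lnXn ?ltr0n // -natrX.
by rewrite ler_ln ?posrE ?ltr0n ?expn_gt0 ?b0 // ler_nat.
Qed.
End RealBounds.

(* Growth of the minimal number of vertices *)
From Stdlib Require Import Reals.
Import Order.TTheory GRing.Theory Num.Theory.
Local Open Scope ring_scope.

Theorem theorem1 (d : nat) : leq 2 d ->
  exists c C : R, 0 < c /\
    forall G : finZmodType, exists n : nat, is_Td d G n /\
      c * (ln (#|G|%:R : R)) `^ (d%:R^-1) <= n%:R /\
      n%:R <= C * (ln (#|G|%:R : R)) `^ (d%:R^-1).
Proof.
move=> d2; have d0 : leq 1 d by apply: ltnW.
have [D upper] := realizable_upper d2.
pose ld : R := exp.ln d.+1%:R; pose l2 : R := exp.ln 2%:R.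
have ld0 : 0 < ld by rewrite ln_gt0 // ltr1n.
have l20 : 0 < l2 by rewrite ln_gt0 // ltr1n.
(* The first constant comes from taking logarithms in [|G| <= (d+1)^(n^d)], the second from
   [n^d <= D^d N] together with [2^N <= |G|]. *)
exists (ld^-1 `^ d%:R^-1), ((D%:R ^+ d / l2) `^ d%:R^-1); split.
  by apply: powR_gt0; rewrite invr_gt0.
move=> G; rewrite RlnE; set lG : R := exp.ln _.
have G0 : leq 1 #|G| by apply/card_gt0P; exists 0.
have lG0 : 0 <= lG by apply: ln_nat_ge0.
have [N [n0 [n0X NG n0N]]] := upper G.
(* Realizability is made boolean classically, so that a least number of vertices can be chosen. *)
have ex_n : exists n, `[< realizable d G n >] by exists n0; apply/asboolP.
have [n /asboolP nX n_min] := ex_minnP ex_n.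
exists n; split; first by split=> // m mX; apply: n_min; apply/asboolP.
split.
  have ldV0 : 0 <= ld^-1 by rewrite invr_ge0 ltW.
  rewrite -powRM //; apply: le_root => //; first exact: mulr_ge0.
  rewrite mulrC ler_pdivrMr // -natrX; apply: le_ln_exp => //.
  exact: realizable_card_le.
have DN0 : 0 <= D%:R ^+ d / l2 by rewrite divr_ge0 ?exprn_ge0 ?ler0n ?ltW.
rewrite -powRM //; apply: root_le => //; first exact: mulr_ge0.
have n_le : leq n n0 by apply: n_min; apply/asboolP.
apply: (@le_trans _ _ ((D%:R ^+ d) * N%:R)).
  rewrite -!natrX -natrM ler_nat; apply: leq_trans n0N.
  by rewrite leq_exp2r.
rewrite -mulrA ler_wpM2l ?exprn_ge0 ?ler0n // mulrC ler_pdivlMr //.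
exact: exp_le_ln.
Qed.
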